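(* Let $A=\{a^1,\dots,a^n\}$ be a te-brick and $C=\operatorname{cone}(A)$. 1. If $A$ is a tu-set, then $\mathcal H(C)=A$. 2. If $A$ is a te-lace, then $\mathcal H(C)=A\cup\{\tfrac12\sum_j a^j\}$. 3. If $A$ is a thin te-interlace, then $\mathcal H(C)=A\cup\{\tfrac12(a^i+a^j)\}_{1\le i<j\le n}$. 4. If $A$ is a thick te-interlace, then in every nonzero column of the matrix $A$ the number of entries equal to $1$ and the number of entries equal to $-1$ have the same parity, this parity $p\in\{0,1\}$ is the same for all nonzero columns, and: (a) if $n\equiv 2p\pmod 4$, then $\mathcal H(C)=A\cup\{\tfrac12(a^i+a^j)\}_{1\le i<j\le n}\cup\{\tfrac14\sum_j a^j\}$; (b) otherwise, $\mathcal H(C)=A\cup\{\tfrac12(a^i+a^j)\}_{1\le i<j\le n}\cup\{\tfrac34a^i+\tfrac14\sum_{j\ne i}a^j\}_{i=1,\dots,n}$.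
   Context: $\operatorname{cone}(A)$ is the set of nonnegative combinations of $A$. For a pointed rational cone $C$, the Hilbert basis $\mathcal H(C)$ is the unique inclusion-minimal finite set of integer vectors of $C$ such that every integer point of $C$ is a nonnegative integer combination of them. A linearly independent set of $\{0,\pm1\}$-vectors (identified with the matrix of its rows) is a tu-set if its matrix is totally unimodular (all square subdeterminants in $\{0,\pm1\}$), a te-set if its matrix is totally equimodular (every linearly independent set of rows has full row rank with all nonzero maximal minors of equal absolute value, the equideterminant), a te-lace if it is a te-set, not a tu-set, with all proper subsets tu-sets, and a te-interlace if it is a te-set, not a tu-set, with every pair of its vectors a te-lace. A te-interlace of size $\ell$ is thin if its equideterminant is $2^{\ell-1}$ and thick if it is $2^\ell$. A te-brick is a tu-set, a te-lace, a thin te-interlace or a thick te-interlace. *)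

(* Defs.v *)
From HB Require Import structures.
From mathcomp Require Import all_boot all_order all_algebra.
From mathcomp Require Export finmap.
Set Implicit Arguments. Unset Strict Implicit. Unset Printing Implicit Defensive.
Import Order.TTheory GRing.Theory Num.Theory.
Local Open Scope ring_scope.

(* A set {a^1,...,a^n} of vectors of Q^m is represented by the n x m matrix
   A whose i-th row is a^i. *)

Definition pm1_mx (n m : nat) (A : 'M[rat]_(n, m)) : Prop :=
  forall i j, A i j \in [:: 0; 1; -1].

Definition TU_mx (n m : nat) (A : 'M[rat]_(n, m)) : Prop :=
  forall (k : nat) (f : 'I_k -> 'I_n) (g : 'I_k -> 'I_m),
    \det (mxsub f g A) \in [:: 0; 1; -1].

Definition TE_mx (n m : nat) (A : 'M[rat]_(n, m)) : Prop :=
  forall (k : nat) (f : 'I_k -> 'I_n), row_free (rowsub f A) ->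
    forall g1 g2 : 'I_k -> 'I_m,
      \det (mxsub f g1 A) != 0 -> \det (mxsub f g2 A) != 0 ->
      `|\det (mxsub f g1 A)| = `|\det (mxsub f g2 A)|.

Definition tu_set (n m : nat) (A : 'M[rat]_(n, m)) : Prop :=
  [/\ pm1_mx A, row_free A & TU_mx A].

Definition te_set (n m : nat) (A : 'M[rat]_(n, m)) : Prop :=
  [/\ pm1_mx A, row_free A & TE_mx A].

Definition te_lace (n m : nat) (A : 'M[rat]_(n, m)) : Prop :=
  [/\ te_set A, ~ tu_set A &
      forall (k : nat) (f : 'I_k -> 'I_n), injective f -> (k < n)%N ->
        tu_set (rowsub f A)].

Definition pair_idx (n : nat) (i j : 'I_n) : 'I_2 -> 'I_n :=
  fun k => if k == ord0 then i else j.

Definition te_interlace (n m : nat) (A : 'M[rat]_(n, m)) : Prop :=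
  [/\ te_set A, ~ tu_set A &
      forall i j : 'I_n, i != j -> te_lace (rowsub (pair_idx i j) A)].

(* the equideterminant of a te-set A (full row rank) is the common absolute
   value of its nonzero maximal (n x n) minors; it equals d iff some maximal
   minor has absolute value d *)
Definition equidet_is (n m : nat) (A : 'M[rat]_(n, m)) (d : rat) : Prop :=
  exists g : 'I_n -> 'I_m, `|\det (colsub g A)| = d.

Definition thin_te_interlace (n m : nat) (A : 'M[rat]_(n, m)) : Prop :=
  te_interlace A /\ equidet_is A (2 ^+ (n.-1)).

Definition thick_te_interlace (n m : nat) (A : 'M[rat]_(n, m)) : Prop :=
  te_interlace A /\ equidet_is A (2 ^+ n).

Definition te_brick (n m : nat) (A : 'M[rat]_(n, m)) : Prop :=
  [\/ tu_set A, te_lace A, thin_te_interlace A | thick_te_interlace A].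

Definition in_cone (n m : nat) (A : 'M[rat]_(n, m)) (x : 'rV[rat]_m) : Prop :=
  exists2 lam : 'rV[rat]_n, (forall i, 0 <= lam 0 i) & x = lam *m A.

Definition int_vec (m : nat) (x : 'rV[rat]_m) : Prop :=
  forall j, x 0 j \is a Num.int.

Definition nonneg_int_comb (m : nat) (H : {fset 'rV[rat]_m}) (x : 'rV[rat]_m)
  : Prop :=
  exists c : 'rV[rat]_m -> nat, x = \sum_(h <- H) h *+ c h.

Definition int_generating (n m : nat) (A : 'M[rat]_(n, m))
  (H : {fset 'rV[rat]_m}) : Prop :=
  (forall h, h \in H -> int_vec h /\ in_cone A h) /\
  (forall x, int_vec x -> in_cone A x -> nonneg_int_comb H x).

Definition is_hilbert_basis (n m : nat) (A : 'M[rat]_(n, m))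
  (H : {fset 'rV[rat]_m}) : Prop :=
  int_generating A H /\
  (forall H' : {fset 'rV[rat]_m}, (H' `<` H)%fset -> ~ int_generating A H').

Definition rows_set (n m : nat) (A : 'M[rat]_(n, m)) : {fset 'rV[rat]_m} :=
  [fset row i A | i in 'I_n]%fset.

Definition half_pairs (n m : nat) (A : 'M[rat]_(n, m)) : {fset 'rV[rat]_m} :=
  [fset (2^-1 *: (row i A + row j A))%R | i in 'I_n, j in [pred j : 'I_n | (nat_of_ord i < nat_of_ord j)%N]]%fset.

Definition three_quarter_set (n m : nat) (A : 'M[rat]_(n, m))
  : {fset 'rV[rat]_m} :=
  [fset ((3%:R / 4%:R) *: row i A + 4^-1 *: \sum_(j < n | j != i) row j A)%R
     | i in 'I_n]%fset.

Definition sum_rows (n m : nat) (A : 'M[rat]_(n, m)) : 'rV[rat]_m :=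
  \sum_(j < n) row j A.

Definition count_col (n m : nat) (A : 'M[rat]_(n, m)) (j : 'I_m) (v : rat)
  : nat := #|[set i : 'I_n | A i j == v]|.

(* Main.v *)
(* Write L for the lattice of the vectors l such that l A is integral, so that
   the integer points of the cone are the l A with l >= 0 in L; only L and the
   Hilbert basis of L intersected with the nonnegative orthant matter. Total
   equimodularity makes L depend on any column basis B of A only.
   - tu-set: B is unimodular, so L = Z^n.
   - te-lace: deleting a row leaves a tu-set, so a vector of L with one integral
     coordinate is integral; all entries of the inverse of B are then +-1/det B,
     and comparing two of its rows gives |det B| = 2. Hence L is Z^n together
     with (1/2, ..., 1/2) + Z^n.
   - te-interlace: the te-laces of size 2 put half the root lattice D_n inside
     L, with index 1 (thin) or 2 (thick). In the thick case, let v represent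
     the other coset and let S be the set of i with 4 v_i odd. If S were not
     everything, restricting to the rows S and one more row t would contradict
     total equimodularity, as seen on the column t of the inverse of a column
     basis. So every coordinate of v is an odd multiple of 1/4, n is even, and
     the coset contains either (1/4, ..., 1/4) or all the vectors obtained from
     it by adding 1/2 to one coordinate. The integrality of v A then determines
     the parities of the column counts. *)

Require Import Defs.
From HB Require Import structures.
From mathcomp Require Import all_boot all_order all_algebra perm finmap.
From mathcomp Require Import ring lra zify.
Import Order.TTheory GRing.Theory Num.Theory.
Local Open Scope ring_scope.
Set Implicit Arguments.
Unset Strict Implicit.
Unset Printing Implicit Defensive.

(** * Coordinates with integral image *)

(** The lattice [L] as a predicate on coordinate vectors: for nonnegative [y] it says that the cone
    point [y *m A] is an integer point. *)
Definition inL (n m : nat) (A : 'M[rat]_(n, m)) (y : 'rV[rat]_n) : bool :=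
  y *m A \is a mxOver Num.int.

Lemma int_vecP (m : nat) (x : 'rV[rat]_m) :
  int_vec x <-> x \is a mxOver Num.int.
Proof.
split=> [h|/mxOverP h j]; last exact: h.
by apply/mxOverP => i j; rewrite ord1.
Qed.

Lemma det_int (n : nat) (A : 'M[rat]_n) :
  A \is a mxOver Num.int -> \det A \is a Num.int.
Proof.
move/mxOverP=> h; rewrite rpred_sum // => s _.
by rewrite rpredM ?rpred_prod // rpredX // rpredN1.
Qed.

Lemma adj_int (n : nat) (A : 'M[rat]_n) :
  A \is a mxOver Num.int -> \adj A \is a mxOver Num.int.
Proof.
move/mxOverP=> h; apply/mxOverP => i j; rewrite mxE /cofactor.
rewrite rpredM ?rpredX ?rpredN1 // det_int //.
by apply/mxOverP => k l; rewrite !mxE.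
Qed.

Lemma pm1_int (n m : nat) (A : 'M[rat]_(n, m)) :
  pm1_mx A -> A \is a mxOver Num.int.
Proof.
move=> h; apply/mxOverP => i j; move: (h i j).
by rewrite !inE => /or3P[] /eqP ->; rewrite ?rpred0 ?rpred1 ?rpredN1.
Qed.

Lemma invmx_adj (n : nat) (B : 'M[rat]_n) :
  \det B != 0 -> invmx B = (\det B)^-1 *: \adj B.
Proof. by move=> h; rewrite /invmx unitmxE unitfE h. Qed.

Lemma det_neq0_unitmx (n : nat) (B : 'M[rat]_n) :
  (\det B != 0) = (B \in unitmx).
Proof. by rewrite unitmxE unitfE. Qed.

(** Expanding the minor along its replaced column [i] produces the cofactors that make up row [i] of
    the adjugate. *)
Lemma cramer (n m k : nat) (A : 'M[rat]_(n, m)) (f : 'I_k -> 'I_n)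
  (g : 'I_k -> 'I_m) i j :
  \det (mxsub f g A) != 0 ->
  (invmx (mxsub f g A) *m rowsub f A) i j =
  \det (mxsub f (fun l => if l == i then j else g l) A) / \det (mxsub f g A).
Proof.
move=> h; rewrite invmx_adj // -scalemxAl mxE mulrC; congr (_ * _).
rewrite (expand_det_col _ i) mxE; apply: eq_bigr => l _.
rewrite !mxE eqxx mulrC; congr (_ * _); rewrite /cofactor; congr (_ * \det _).
by apply/matrixP => u v; rewrite !mxE eq_sym (negPf (neq_lift _ _)).
Qed.

Lemma mxsub_row_free (n m k : nat) (A : 'M[rat]_(n, m)) (f : 'I_k -> 'I_n)
  (g : 'I_k -> 'I_m) : \det (mxsub f g A) != 0 -> row_free (rowsub f A).
Proof.
rewrite det_neq0_unitmx => h; apply: inj_row_free => v hv.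
have : v *m mxsub f g A = 0.
  have -> : mxsub f g A = colsub g (rowsub f A) by apply/matrixP=> i j; rewrite !mxE.
  by rewrite mulmx_colsub hv; apply/matrixP=> i j; rewrite !mxE.
by move/(congr1 (mulmxr (invmx (mxsub f g A)))); rewrite /= mulmxK // mul0mx.
Qed.

(* Cramer's rule: the coordinates of the columns of a row submatrix in a
   column basis are quotients of maximal minors, hence 0, 1 or -1. *)
Lemma TE_factor (n m k : nat) (A : 'M[rat]_(n, m)) (f : 'I_k -> 'I_n)
  (g : 'I_k -> 'I_m) : TE_mx A -> \det (mxsub f g A) != 0 ->
  exists2 T : 'M[rat]_(k, m), T \is a mxOver Num.int &
    rowsub f A = mxsub f g A *m T.
Proof.
move=> hA h; exists (invmx (mxsub f g A) *m rowsub f A); last first.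
  by rewrite mulKVmx // -det_neq0_unitmx.
apply/mxOverP => i j; rewrite cramer //.
set d := \det (mxsub f (fun _ => _) A).
have [->|hd] := eqVneq d 0; first by rewrite mul0r rpred0.
have /eqP := hA k f (mxsub_row_free h) _ _ hd h.
rewrite -/d eqr_norm2 => /orP[] /eqP ->; first by rewrite divff ?rpred1.
by rewrite mulNr divff ?rpredN1.
Qed.

(** By [TE_factor] all columns are integral combinations of the chosen ones, so integrality need
    only be tested on a column basis. *)
Lemma inL_mxsub (n m k : nat) (A : 'M[rat]_(n, m)) (f : 'I_k -> 'I_n)
  (g : 'I_k -> 'I_m) y : TE_mx A -> \det (mxsub f g A) != 0 ->
  inL (mxsub f g A) y = inL (rowsub f A) y.
Proof.
move=> hA h; apply/idP/idP => hy.
  have [T hT E] := TE_factor hA h.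
  by rewrite /inL E mulmxA mxOverM.
have -> : mxsub f g A = colsub g (rowsub f A) by apply/matrixP=> i j; rewrite !mxE.
rewrite /inL mulmx_colsub; apply/mxOverP=> i j; rewrite mxE.
by move/mxOverP: hy.
Qed.

Lemma rowsub_id (n m : nat) (A : 'M[rat]_(n, m)) : rowsub id A = A.
Proof. by apply/matrixP => i j; rewrite mxE. Qed.

Lemma inL_colsub (n m : nat) (A : 'M[rat]_(n, m)) (g : 'I_n -> 'I_m) y :
  TE_mx A -> \det (colsub g A) != 0 -> inL (colsub g A) y = inL A y.
Proof. by move=> hA h; rewrite inL_mxsub // rowsub_id. Qed.

Lemma TE_mxsub (n m k l : nat) (A : 'M[rat]_(n, m)) (f : 'I_k -> 'I_n)
  (g : 'I_l -> 'I_m) : TE_mx A -> TE_mx (mxsub f g A).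
Proof.
have E u v w (f' : 'I_u -> 'I_k) (g' : 'I_v -> 'I_w) (g0 : 'I_w -> 'I_m) :
  mxsub f' g' (mxsub f g0 A) = mxsub (f \o f') (g0 \o g') A.
  by apply/matrixP=> i j; rewrite !mxE.
move=> hA u f' hf' g1 g2; rewrite !E; apply: hA.
apply: inj_row_free => v hv.
have /row_free_inj := hf'; apply; rewrite mul0mx.
have -> : rowsub f' (mxsub f g A) = colsub g (rowsub (f \o f') A).
  by apply/matrixP=> i j; rewrite !mxE.
by rewrite mulmx_colsub hv; apply/matrixP=> i j; rewrite !mxE.
Qed.

Lemma row_free_colsub (n m : nat) (A : 'M[rat]_(n, m)) :
  row_free A -> exists g : 'I_n -> 'I_m, \det (colsub g A) != 0.
Proof.
move=> hA; have hT : row_full A^T by rewrite /row_full mxrank_tr.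
exists (fullrankfun hT).
have := fullrowsub_unit hT; rewrite -unitmx_tr det_neq0_unitmx.
by congr (_ \in unitmx); apply/matrixP => i j; rewrite !mxE.
Qed.

Lemma inL_row_invmx (n : nat) (B : 'M[rat]_n) j :
  \det B != 0 -> inL B (row j (invmx B)).
Proof.
rewrite det_neq0_unitmx => h.
rewrite /inL -row_mul mulVmx //; apply/mxOverP=> a b; rewrite !mxE.
by rewrite natr_int.
Qed.

Lemma inLD (n m : nat) (A : 'M[rat]_(n, m)) y z :
  inL A y -> inL A z -> inL A (y + z).
Proof.
move=> /mxOverP hy /mxOverP hz; rewrite /inL mulmxDl; apply/mxOverP=> i j.
by rewrite mxE rpredD.
Qed.

Lemma inLN (n m : nat) (A : 'M[rat]_(n, m)) y : inL A y -> inL A (- y).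
Proof.
move=> /mxOverP hy; rewrite /inL mulNmx; apply/mxOverP=> i j.
by rewrite mxE rpredN.
Qed.

Lemma inLB (n m : nat) (A : 'M[rat]_(n, m)) y z :
  inL A y -> inL A z -> inL A (y - z).
Proof. by move=> hy hz; apply/inLD/inLN. Qed.

Lemma inLZ (n m : nat) (A : 'M[rat]_(n, m)) (c : rat) y :
  c \is a Num.int -> inL A y -> inL A (c *: y).
Proof.
move=> hc /mxOverP hy; rewrite /inL -scalemxAl.
by apply/mxOverP=> i j; rewrite mxE rpredM.
Qed.

Lemma inL_int (n m : nat) (A : 'M[rat]_(n, m)) y :
  A \is a mxOver Num.int -> y \is a mxOver Num.int -> inL A y.
Proof. by move=> hA hy; apply: mxOverM. Qed.

(** For injective [f], multiplication by [rowsub f 1%:M] extends a vector by zero; lattices of row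
    subsets thus become coordinate slices of the lattice of [A]. *)
Lemma inL_rowsub (n m k : nat) (A : 'M[rat]_(n, m)) (f : 'I_k -> 'I_n) y :
  inL (rowsub f A) y = inL A (y *m rowsub f 1%:M).
Proof. by rewrite /inL -mulmxA -rowsubE. Qed.

Lemma mul_rowsub1 (n k : nat) (f : 'I_k -> 'I_n) (y : 'rV[rat]_k) i :
  injective f -> (y *m rowsub f 1%:M) 0 (f i) = y 0 i.
Proof.
move=> fI; rewrite mxE (bigD1 i) //= !mxE eqxx mulr1 big1 ?addr0 // => l hl.
by rewrite !mxE (inj_eq fI) (negPf hl) mulr0.
Qed.

Lemma mul_rowsub1_out (n k : nat) (f : 'I_k -> 'I_n) (y : 'rV[rat]_k) l :
  l \notin codom f -> (y *m rowsub f 1%:M) 0 l = 0.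
Proof.
move=> hl; rewrite mxE big1 // => i _; rewrite !mxE.
case: eqP => [E|]; last by rewrite mulr0.
by rewrite -E codom_f in hl.
Qed.

Lemma rowsub_mul_inj (n k : nat) (f : 'I_k -> 'I_n) (y : 'rV[rat]_n) :
  injective f -> (forall l, l \notin codom f -> y 0 l = 0) ->
  colsub f y *m rowsub f 1%:M = y.
Proof.
move=> fI hy; apply/rowP=> l; have [/codomP[i ->]|hl] := boolP (l \in codom f).
  by rewrite mul_rowsub1 // mxE.
by rewrite mul_rowsub1_out // hy.
Qed.

(** * Inverses of totally equimodular matrices *)

Definition odd_int (x : rat) : bool := 2^-1 * (x - 1) \is a Num.int.

Lemma odd_intP (x : rat) : reflect (exists m : int, x = (m * 2 + 1)%:~R) (odd_int x).
Proof.
apply: (iffP intrP) => -[m E]; exists m.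
  by rewrite rmorphD rmorphM /= -E; field.
by rewrite E rmorphD rmorphM /=; field.
Qed.

Lemma odd_int_int x : odd_int x -> x \is a Num.int.
Proof. by move/odd_intP=> [m ->]; rewrite intr_int. Qed.

Lemma half_or_odd (x : rat) : x \is a Num.int -> (2^-1 * x \is a Num.int) || odd_int x.
Proof.
move/intrP=> [m ->].
have [k [->|->]] : exists k : int, m = k * 2 \/ m = k * 2 + 1.
  by exists (m %/ 2)%Z; lia.
- by apply/orP; left; apply/intrP; exists k; rewrite rmorphM /=; field.
- by apply/orP; right; apply/odd_intP; exists k.
Qed.

Lemma odd_int_half x : odd_int x -> 2^-1 * x \isn't a Num.int.
Proof.
move/odd_intP=> [m ->]; apply/negP => /intrP[k].
rewrite rmorphD rmorphM /= => h.
have : (m * 2 + 1)%:~R = (k * 2)%:~R :> rat by rewrite rmorphD !rmorphM /=; lra.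
by move/intr_inj; lia.
Qed.

Lemma int_mul1 (x y : rat) : x \is a Num.int -> y \is a Num.int -> x * y = 1 ->
  y = 1 \/ y = -1.
Proof.
move=> /intrP[a ->] /intrP[b ->] h.
have {}h : a * b = 1 by apply: (@intr_inj rat); rewrite rmorphM.
have /eqP : (`|a| * `|b| = 1)%N by rewrite -abszM h.
rewrite muln_eq1 => /andP[_ hb].
have [->|->] : b = 1 \/ b = -1 by lia.
- by left.
- by right.
Qed.

Lemma odd_int_mul2 (x y : rat) : x \is a Num.int -> odd_int y -> x * y = 2 ->
  y = 1 \/ y = -1.
Proof.
move=> /intrP[a ->] /odd_intP[b ->] h.
have {}h : a * (b * 2 + 1) = 2 by apply: (@intr_inj rat); rewrite rmorphM.
have e : (`|a| * absz (b * 2 + 1)%R = 2)%N by rewrite -abszM h.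
have : (absz (b * 2 + 1)%R <= 2)%N by apply: dvdn_leq; rewrite // -[X in (_ %| X)%N]e dvdn_mull.
move=> {}h; have [->|->] : b = 0 \/ b = -1 by lia.
- by left.
- by right.
Qed.

(** Up to sign, the entries of column [i] of the inverse are maximal minors of the rows other than
    [i], divided by [\det B]; total equimodularity gives the nonzero ones one absolute value. *)
Lemma invmx_col (n : nat) (B : 'M[rat]_n) (i : 'I_n) :
  TE_mx B -> \det B != 0 -> exists2 j0, invmx B j0 i != 0 &
   forall j, exists2 c, c \in [:: 0; 1; -1] & invmx B j i = c * invmx B j0 i.
Proof.
case: n B i => [|n] B i; first by case: i.
move=> hTE h; have hu : B \in unitmx by rewrite -det_neq0_unitmx.
have [j0 hj0|/= h0] := pickP (fun j => invmx B j i != 0); last first.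
  have := congr1 (fun M : 'M_n.+1 => M i i) (mulmxV hu).
  rewrite mxE big1 ?mxE ?eqxx => [/eqP|j _]; first by rewrite eq_sym oner_eq0.
  by move/negbFE/eqP: (h0 j) => ->; rewrite mulr0.
exists j0 => // j.
have E l : invmx B l i = (-1) ^+ (i + l) * \det (mxsub (lift i) (lift l) B) / \det B.
  by rewrite invmx_adj // !mxE mulrC /cofactor; congr (_ * \det _ / _);
    apply/matrixP => u v; rewrite !mxE.
have [->|hj] := eqVneq (invmx B j i) 0; first by exists 0; rewrite ?mul0r.
have d0 l : invmx B l i != 0 -> \det (mxsub (lift i) (lift l) B) != 0.
  by apply: contra => /eqP e; rewrite E e mulr0 mul0r.
have e : `|invmx B j i| = `|invmx B j0 i|.
  rewrite !E !normrM !normrX normrN1 !expr1n !mul1r; congr (_ * _).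
  by apply: hTE; rewrite ?d0 //; exact: (mxsub_row_free (d0 _ hj)).
move/eqP: e; rewrite eqr_norm2 => /orP[] /eqP ->.
- by exists 1; rewrite ?mul1r.
- by exists (-1); rewrite ?mulN1r.
Qed.

(** Since [y] is [y *m B] times the inverse, its coordinate [i] is an integral combination of column
    [i] of the inverse, hence an integral multiple of the generator [invmx B j0 i]. *)
Lemma inL_proj (n : nat) (B : 'M[rat]_n) (i j0 : 'I_n) y : \det B != 0 ->
  (forall j, exists2 c, c \in [:: 0; 1; -1] & invmx B j i = c * invmx B j0 i) ->
  inL B y -> exists2 z, z \is a Num.int & y 0 i = z * invmx B j0 i.
Proof.
move=> h hc /mxOverP hy; have hu : B \in unitmx by rewrite -det_neq0_unitmx.
have [c cE] : exists c : 'I_n -> rat, forall j, c j \is a Num.int /\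
    invmx B j i = c j * invmx B j0 i.
  exists (fun j => if invmx B j i == 0 then 0 else invmx B j i / invmx B j0 i) => j.
  have [c hc1 hc2] := hc j.
  case: eqP => [->|/eqP]; first by rewrite mul0r rpred0.
  rewrite hc2 mulf_eq0 negb_or => /andP[_ h0]; rewrite mulfK //.
  by split=> //; move: hc1; rewrite !inE => /or3P[] /eqP ->; rewrite ?rpred0 ?rpred1 ?rpredN1.
exists (\sum_j (y *m B) 0 j * c j).
  by rewrite rpred_sum // => j _; rewrite rpredM ?hy //; case: (cE j).
rewrite -{1}(mulmxK hu y) mxE mulr_suml; apply: eq_bigr => j _.
by rewrite (proj2 (cE j)) mulrA.
Qed.

Lemma half_pair_inL (n m : nat) (B : 'M[rat]_(n, m)) i j :
  (forall i j, B i j = 1 \/ B i j = -1) ->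
  inL B (2^-1 *: (delta_mx 0 i + delta_mx 0 j)).
Proof.
move=> hB; apply/mxOverP => a k; rewrite -scalemxAl mulmxDl -!rowE !mxE.
by case: (hB i k) (hB j k) => -> [] ->; apply/intrP;
  [exists 1 | exists 0 | exists 0 | exists (-1)]; rewrite /=; field.
Qed.

Lemma odd_sum_signs (n : nat) (c : 'I_n -> rat) :
  (forall j, c j = 1 \/ c j = -1) -> 2^-1 * (\sum_j c j - n%:R) \is a Num.int.
Proof.
move=> hc.
have -> : 2^-1 * (\sum_j c j - n%:R) = \sum_(j < n) 2^-1 * (c j - 1).
  by rewrite -mulr_sumr sumrB sumr_const card_ord.
rewrite rpred_sum // => j _; case: (hc j) => ->; apply/intrP; [exists 0|exists (-1)].
  by rewrite /=; field.
by rewrite /=; field.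
Qed.

Lemma sum_two (V : nmodType) (n : nat) (F : 'I_n -> V) (i j : 'I_n) :
  i != j -> (forall k, k != i -> k != j -> F k = 0) -> \sum_k F k = F i + F j.
Proof.
move=> ij h; rewrite (bigD1 i) //= (bigD1 j) 1?eq_sym //= big1 ?addr0 //.
by move=> k /andP[ki kj]; rewrite h.
Qed.

Lemma half_nint : (2^-1 : rat) \isn't a Num.int.
Proof. by have := @odd_int_half 1; rewrite mulr1; apply; apply/odd_intP; exists 0. Qed.

Lemma codom_lift2 (q : nat) (t : 'I_q.+2) (s' : 'I_q.+1) l :
  (l \in codom (lift t \o lift s')) = (l != t) && (l != lift t s').
Proof.
apply/codomP/andP => [[k ->]|[h1 h2]] /=.
  by rewrite !(inj_eq lift_inj) eq_sym neq_lift eq_sym neq_lift.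
case: (unliftP t l) h1 h2 => [k ->|->]; last by rewrite eqxx.
rewrite (inj_eq lift_inj) => _; case: (unliftP s' k) => [k' ->|->]; last by rewrite eqxx.
by move=> _; exists k'.
Qed.

(** The situation to be excluded in the thick case: by [hL] and [hv], lattice vectors lie in half of
    [D_n] or are odd multiples of 1/4 at every index but [t], where they are multiples of 1/2, and
    the second kind occurs. *)
Section PartialCode.
Variables (q : nat) (B : 'M[rat]_q.+2) (t : 'I_q.+2).
Hypothesis hTE : TE_mx B.
Hypothesis hB : forall i j, B i j = 1 \/ B i j = -1.
Hypothesis hdet : \det B != 0.
Hypothesis hL : forall y, inL B y -> 2 * y 0 t \is a Num.int /\
  ((forall i, 2 * y 0 i \is a Num.int) /\ \sum_i y 0 i \is a Num.int \/
   forall i, i != t -> odd_int (4 * y 0 i)).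
Hypothesis hv : exists2 v, inL B v & forall i, i != t -> odd_int (4 * v 0 i).

Let C := invmx B.
Let hu : B \in unitmx. Proof. by rewrite -det_neq0_unitmx. Qed.

(** The half-pair through [t] shows that 1/2 is an integral multiple of the generator of column [t],
    and [hL] makes twice this generator integral; so it is 1/2 up to sign. *)
Lemma inv_t j : 2 * C j t \in [:: 0; 1; -1].
Proof.
have [j0 h0 hc] := invmx_col t hTE hdet.
have [z hz Ez] := inL_proj hdet hc (half_pair_inL t (lift t ord0) hB).
have := Ez; rewrite !mxE !eqxx /= (negPf (neq_lift _ _)) mulr0n addr0 => e.
have [h2 _] := hL (inL_row_invmx j0 hdet); rewrite mxE in h2.
have e1 : z * (2 * invmx B j0 t) = 1 by rewrite mulrCA -e; field.
have [c hc1 hc2] := hc j.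
have -> : 2 * C j t = c * (2 * invmx B j0 t) by rewrite /C hc2; ring.
by move: hc1; rewrite !inE; case: (int_mul1 hz h2 e1) => -> /or3P[] /eqP ->;
 rewrite ?mul0r ?mulr1 ?mul1r ?mulrNN ?mulrN1 ?opprK ?eqxx ?orbT.
Qed.

(** The half-pair through [s] shows that four times the generator of column [s] divides 2, and [hL]
    with [hv] shows that it is odd. *)
Lemma inv_s0 j s : s != t -> 4 * C j s \in [:: 0; 1; -1].
Proof.
move=> st.
have [j0 h0 hc] := invmx_col s hTE hdet.
have [z hz Ez] := inL_proj hdet hc (half_pair_inL s t hB).
have := Ez; rewrite !mxE !eqxx /= (negPf st) mulr0n addr0 => e.
have e1 : z * (4 * invmx B j0 s) = 2 by rewrite mulrCA -e; field.
have ho : odd_int (4 * invmx B j0 s).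
  have [_ [[h2 _]|h2]] := hL (inL_row_invmx j0 hdet); last first.
    by have := h2 _ st; rewrite mxE.
  have [v vL hvs] := hv; have [z' hz' Ez'] := inL_proj hdet hc vL.
  have := odd_int_half (hvs s st); rewrite Ez'.
  have -> : 2^-1 * (4 * (z' * invmx B j0 s)) = z' * (2 * invmx B j0 s) by field.
  by have := h2 s; rewrite mxE => h3; rewrite rpredM.
have [c hc1 hc2] := hc j.
have -> : 4 * C j s = c * (4 * invmx B j0 s) by rewrite /C hc2; ring.
by move: hc1; rewrite !inE; case: (odd_int_mul2 hz ho e1) => -> /or3P[] /eqP ->;
 rewrite ?mul0r ?mulr1 ?mul1r ?mulrNN ?mulrN1 ?opprK ?eqxx ?orbT.
Qed.

(** A row of the inverse lying in half of [D_n] would vanish off [t] by [inv_s0], then at [t] by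
    [inv_t] and its integral sum; a zero row is impossible. In every other row [4 * C j s] is
    odd. *)
Lemma inv_s j s : s != t -> 4 * C j s = 1 \/ 4 * C j s = -1.
Proof.
move=> st.
have [_ [[h2 h3]|h2]] := hL (inL_row_invmx j hdet); last first.
  have := h2 s st; rewrite mxE => h3.
  have := inv_s0 j st; rewrite !inE => /or3P[] /eqP E; [|by left|by right].
  by have := odd_int_half h3; rewrite E mulr0 rpred0.
exfalso.
have nh : 2^-1 \isn't a @Num.int rat := half_nint.
have C0 k : k != t -> C j k = 0.
  move=> kt; have := inv_s0 j kt; have := h2 k; rewrite mxE -/C.
  have -> : 2 * C j k = 2^-1 * (4 * C j k) by field.
  rewrite !inE => + /or3P[] /eqP E; rewrite E ?mulr1 ?mulrN1 ?rpredN ?(negPf nh) // => _.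
  by have -> : C j k = 4^-1 * (4 * C j k); [field | rewrite E mulr0].
have Ct : C j t = 0.
  move: h3; rewrite (bigD1 t) //= big1 ?addr0; last by move=> k kt; rewrite mxE C0.
  rewrite mxE -/C; have e : C j t = 2^-1 * (2 * C j t) by field.
  rewrite e; have := inv_t j.
  by rewrite !inE => /or3P[] /eqP ->; rewrite ?mulr0 // ?mulr1 ?mulrN1 ?rpredN ?(negPf nh).
have /rowP/(_ j) : row j C *m B = 0.
  rewrite (_ : row j C = 0) ?mul0mx //; apply/rowP=> k; rewrite !mxE.
  by have [->|/C0] := eqVneq k t.
by rewrite -row_mul mulVmx // !mxE eqxx => /eqP; rewrite oner_eq0.
Qed.

(* If a zero [l] and nonzeros [i], [j] occur in column [t] of the inverse, then
   deleting rows [s], [t] and columns [i], [j] leaves a nonsingular matrix, and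
   a half-integral combination of the rows [l], [i], [j] of the inverse is
   integral on the kept columns but not on column [i]. *)
Lemma inv_col_t_full i j l s : s != t -> C i t != 0 -> C j t != 0 -> i != j ->
  C l t = 0 -> C i s = (4 * (C i t * C j t)) * C j s.
Proof.
move=> st hi hj ij hl; apply/eqP/negPn/negP => hs.
have sg k : C k t != 0 -> 2 * C k t = 1 \/ 2 * C k t = -1.
  have := inv_t k; rewrite !inE => /or3P[] /eqP E; [|by left|by right].
  by have -> : C k t = 2^-1 * (2 * C k t); [field | rewrite E mulr0 eqxx].
set e := 4 * (C i t * C j t) in hs *.
have ee : e = (2 * C i t) * (2 * C j t) by rewrite /e; ring.
have e1 : e = 1 \/ e = -1.
  by rewrite ee; case: (sg _ hi) (sg _ hj) => -> [] ->;
     rewrite ?mulN1r ?mul1r ?opprK; auto.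
have li : l != i by apply: contraNneq hi => <-; rewrite hl.
have lj : l != j by apply: contraNneq hj => <-; rewrite hl.
(* The sign [e] makes [u] vanish at [t]; the negated claim [hs] keeps it nonzero at [s]. *)
pose u := row i C - e *: row j C.
have ut : u 0 t = 0.
  rewrite !mxE; have -> : C i t - e * C j t =
    2^-1 * (2 * C i t) * (1 - (2 * C j t) * (2 * C j t)) by rewrite ee; field.
  by case: (sg _ hj) => ->; rewrite ?mulrNN mulr1 subrr mulr0.
have us : 2 * u 0 s = 1 \/ 2 * u 0 s = -1.
  have : u 0 s != 0 by rewrite !mxE subr_eq0.
  have -> : u 0 s = 4^-1 * (4 * C i s - e * (4 * C j s)) by rewrite !mxE; field.
  case: (inv_s i st) (inv_s j st) e1 => -> [] -> [] ->;
    rewrite ?mulr1 ?mulrNN ?mul1r ?opprK ?subrr ?mulr0 ?eqxx // ?addNr ?mulr0 ?eqxx // => _;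
    by [left; field | right; field].
have us0 : u 0 s != 0.
  by apply/eqP=> h0; move: us; rewrite h0 mulr0; case=> /eqP; rewrite eq_sym ?oppr_eq0 oner_eq0.
have [s' Es] : exists s', s = lift t s'.
  by case: (unliftP t s) st => [s' ->|->]; [exists s' | rewrite eqxx].
have [j' Ej] : exists j', j = lift i j'.
  by case: (unliftP i j) ij => [j' ->|->]; [exists j' | rewrite eqxx].
pose f := lift t \o lift s'; pose g := lift i \o lift j'.
have fI : injective f by move=> a b /lift_inj /lift_inj.
have fout k : k \notin codom f -> k = t \/ k = s.
  by rewrite codom_lift2 -Es negb_and !negbK => /orP[] /eqP; auto.
have gout k : (k \in codom g) = (k != i) && (k != j) by rewrite codom_lift2 -Ej.
have uB : u *m B = delta_mx 0 i - e *: delta_mx 0 j.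
  by rewrite mulmxBl -scalemxAl -!row_mul mulVmx // !row1.
have subE (y : 'rV_q) k : (y *m mxsub f g B) 0 k = (y *m rowsub f 1%:M *m B) 0 (g k).
  by rewrite -mulmxA -rowsubE !mxE; apply: eq_bigr => a _; rewrite !mxE.
(* The zero extension of a kernel vector is a combination of rows [i] and [j] of the inverse;
   vanishing at [t] makes it a multiple of [u], and vanishing at [s] makes it zero. *)
have hd : \det (mxsub f g B) != 0.
  rewrite det_neq0_unitmx -row_free_unit; apply: inj_row_free => y hy.
  pose yy := y *m rowsub f 1%:M; pose w := yy *m B.
  have w0 k : k != i -> k != j -> w 0 k = 0.
    move=> ki kj; have /codomP[k' ->] : k \in codom g by rewrite gout ki kj.
    by rewrite -subE hy mxE.
  have Ey k : yy 0 k = w 0 i * C i k + w 0 j * C j k.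
    rewrite -(mulmxK hu yy) mxE (sum_two ij) // => a ai aj.
    by rewrite -/w w0 // mul0r.
  have outs k : k = t \/ k = s -> yy 0 k = 0.
    move=> hk; apply: mul_rowsub1_out; rewrite codom_lift2 -Es.
    by case: hk => ->; rewrite eqxx ?andbF.
  have wj : w 0 j = - e * w 0 i.
    have := outs t (or_introl erefl); rewrite Ey => h0.
    have -> : w 0 j = w 0 j * ((2 * C j t) * (2 * C j t)).
      by case: (sg _ hj) => ->; rewrite ?mulrNN !mulr1.
    have -> : w 0 j * (2 * C j t * (2 * C j t)) =
      (w 0 i * C i t + w 0 j * C j t) * (4 * C j t) - e * w 0 i by rewrite /e; ring.
    by rewrite h0 mul0r add0r mulNr.
  have wi : w 0 i = 0.
    have := outs s (or_intror erefl); rewrite Ey wj => h0.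
    have : w 0 i * u 0 s = 0 by rewrite -h0 !mxE; ring.
    by move/eqP; rewrite mulf_eq0 (negPf us0) orbF => /eqP.
  apply/rowP=> k; rewrite -(mul_rowsub1 y k fI) -/yy Ey wj wi mxE.
  by rewrite mulr0 !mul0r addr0.
(* Row [l] already vanishes at [t]; this multiple of [u] cancels it at [s], so [y0] is supported on
   the kept rows. *)
pose a := - C l s / u 0 s.
have ha : 2 * a = 1 \/ 2 * a = -1.
  have : 2 * u 0 s * (2 * a) = - (4 * C l s) by rewrite /a; field.
  by case: us (inv_s l st) => -> [] ->; rewrite ?mul1r ?mulN1r ?opprK;
    [right|left|left|right]; rewrite -?e0 //; apply/oppr_inj; rewrite ?opprK.
pose y0 := row l C + a *: u.
have y0B : y0 *m B = delta_mx 0 l + a *: (delta_mx 0 i - e *: delta_mx 0 j).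
  by rewrite mulmxDl -scalemxAl uB -row_mul mulVmx // row1.
have y0E : colsub f y0 *m rowsub f 1%:M = y0.
  apply: rowsub_mul_inj => // k /fout[] ->; rewrite mxE [(a *: u) _ _]mxE.
    by rewrite ut mulr0 addr0 mxE.
  by rewrite /a mulfVK // mxE subrr.
(* Integrality on the kept columns spreads to all columns by total equimodularity, but on column [i]
   the image of [y0] is [a], which is 1/2 up to sign. *)
have : inL (mxsub f g B) (colsub f y0).
  apply/mxOverP=> k1 k; rewrite ord1 subE y0E y0B.
  have : g k \in codom g by apply: codom_f.
  rewrite gout => /andP[/negPf gi /negPf gj].
  by rewrite !mxE gi gj /= mulr0 subrr mulr0 addr0 natr_int.
rewrite inL_mxsub // inL_rowsub y0E => /mxOverP/(_ 0 i).
rewrite y0B !mxE !eqxx [i == l]eq_sym (negPf li) (negPf ij) /= mulr0 subr0 mulr1 add0r => hai.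
clear -hai ha; clearbody a; have /negP := half_nint; apply.
case: ha => h.
- by have -> : 2^-1 = a by lra.
- by have -> : 2^-1 = - a; [lra | rewrite rpredN].
Qed.

(** If column [t] of the inverse had no zero, the diagonal entry of [B *m C] at [t] would write 2 as
    a sum of [q.+2] signs, an odd number of them. With a zero and two nonzeros at [i] and [j], rows
    [i] and [j] of the inverse agree up to sign, against invertibility. *)
Lemma partial_code_false : odd q -> False.
Proof.
move=> oq; have nh := half_nint.
have [l hl] : exists l, C l t = 0.
  have [l /eqP hl|/= h0] := pickP (fun l => C l t == 0); first by exists l.
  exfalso.
  have sg k : 2 * C k t = 1 \/ 2 * C k t = -1.
    have := inv_t k; rewrite !inE => /or3P[] /eqP E; [|by left|by right].
    have := h0 k; have -> : C k t = 2^-1 * (2 * C k t) by field.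
    by rewrite E mulr0 eqxx.
  have /matrixP/(_ t t) := mulmxV hu; rewrite -/C !mxE eqxx => e1.
  have := @odd_sum_signs q.+2 (fun j => B t j * (2 * C j t)).
  have -> : \sum_(j < q.+2) B t j * (2 * C j t) = 2.
    transitivity (2 * \sum_j B t j * C j t); last by rewrite e1 mulr1.
    by rewrite mulr_sumr; apply: eq_bigr => j _; rewrite mulrCA.
  move=> h; have {}h : 2^-1 * (2 - q.+2%:R) \is a @Num.int rat.
    by apply: h => j; case: (hB t j) (sg j) => -> [] ->;
      rewrite ?mulN1r ?mul1r ?opprK; auto.
  move/negP: nh; apply.
  have -> : 2^-1 = - (2^-1 * (2 - q.+2%:R)) - (q./2)%:R :> rat.
    have -> : q.+2%:R = (q./2)%:R * 2 + 3 :> rat; last by field.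
    by rewrite -natrM -natrD; congr _%:R; lia.
  by rewrite rpredB ?rpredN ?natr_int.
pose s := lift t ord0; have st : s != t by rewrite eq_sym neq_lift.
have [i hi] : exists i, C i t != 0.
  by have [i hi _] := invmx_col t hTE hdet; exists i.
(* A single nonzero in column [t] would make the off-diagonal entry [(s, t)] of [B *m C] nonzero. *)
have [j hj ij] : exists2 j, C j t != 0 & i != j.
  have [j /andP[h1 h2]|/= h0] := pickP (fun j => (C j t != 0) && (i != j)); first by exists j.
  exfalso.
  have /matrixP/(_ s t) := mulmxV hu; rewrite -/C !mxE (negPf st) (bigD1 i) //= big1.
    by move/eqP; rewrite addr0 mulf_eq0 (negPf hi) orbF; case: (hB s i) => ->;
       rewrite ?oppr_eq0 oner_eq0.
  move=> k ki; have := h0 k; rewrite [i == k]eq_sym ki andbT => /negbFE/eqP ->.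
  by rewrite mulr0.
pose e := 4 * (C i t * C j t).
have : row i C = e *: row j C.
  apply/rowP=> k; have [->|kt] := eqVneq k t; last first.
    by rewrite !mxE; exact: inv_col_t_full kt hi hj ij hl.
  rewrite !mxE /e; have : 2 * C j t = 1 \/ 2 * C j t = -1.
    have := inv_t j; rewrite !inE => /or3P[] /eqP E; [|by left|by right].
    by move: hj; have -> : C j t = 2^-1 * (2 * C j t); [field | rewrite E mulr0 eqxx].
  move=> h; have -> : 4 * (C i t * C j t) * C j t = C i t * ((2 * C j t) * (2 * C j t)) by ring.
  by case: h => ->; rewrite ?mulrNN !mulr1.
move/(congr1 (mulmxr B)) => /=; rewrite -scalemxAl -!row_mul mulVmx // !row1.
move/rowP/(_ i); rewrite !mxE !eqxx (negPf ij) /= mulr0 => /eqP.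
by rewrite oner_eq0.
Qed.
End PartialCode.

(** * Tu-sets and te-laces *)

Lemma unimodular_inL (n : nat) (B : 'M[rat]_n) y :
  B \is a mxOver Num.int -> \det B = 1 \/ \det B = -1 ->
  inL B y -> y \is a mxOver Num.int.
Proof.
move=> hB hd hy; have hd0 : \det B != 0.
  by case: hd => ->; rewrite ?oppr_eq0 oner_eq0.
rewrite -(mulmxK (_ : B \in unitmx) y) -?det_neq0_unitmx //.
apply: mxOverM => //; rewrite invmx_adj //; have /mxOverP ha := adj_int hB.
apply/mxOverP=> i j; rewrite mxE rpredM //.
by case: hd => ->; rewrite ?invrN1 ?invr1 ?rpredN1 ?rpred1.
Qed.

Lemma tu_set_inL (n m : nat) (A : 'M[rat]_(n, m)) y :
  tu_set A -> inL A y -> y \is a mxOver Num.int.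
Proof.
case=> h1 h2 h3 hy; have [g hg] := row_free_colsub h2.
apply: (@unimodular_inL _ (colsub g A)).
- by have /mxOverP h := pm1_int h1; apply/mxOverP=> i j; rewrite mxE.
- have := h3 n id g; rewrite !inE (negPf hg) /=.
  by case/orP=> /eqP; [left|right].
- move: hy; rewrite /inL mulmx_colsub => /mxOverP hy.
  by apply/mxOverP=> i j; rewrite mxE.
Qed.

Lemma det_noninj_rows (n m k : nat) (A : 'M[rat]_(n, m)) (f : 'I_k -> 'I_n)
  (g : 'I_k -> 'I_m) : ~~ injectiveb f -> \det (mxsub f g A) = 0.
Proof.
case/injectivePn=> i [j ij e]; apply: (determinant_alternate ij) => l.
by rewrite !mxE e.
Qed.

Lemma TU_small (n m : nat) (A : 'M[rat]_(n, m)) :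
  pm1_mx A -> (n <= 1)%N -> TU_mx A.
Proof.
move=> hA n1 k f g; have [/injectiveP fI|/(det_noninj_rows A g)->] := boolP (injectiveb f);
  last by [].
have := leq_card f fI; rewrite !card_ord => kn.
have {kn n1} := leq_trans kn n1.
case: k f g fI => [|[|//]] f g _ _; first by rewrite det_mx00.
by rewrite det_mx11 mxE.
Qed.

Lemma te_lace_size (n m : nat) (A : 'M[rat]_(n, m)) : te_lace A -> (1 < n)%N.
Proof.
case=> -[h1 h2 _] h3 _; rewrite ltnNge; apply/negP=> n1; apply: h3.
by split=> //; apply: TU_small.
Qed.

Lemma te_interlace_size (n m : nat) (A : 'M[rat]_(n, m)) : te_interlace A -> (1 < n)%N.
Proof.
case=> -[h1 h2 _] h3 _; rewrite ltnNge; apply/negP=> n1; apply: h3.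
by split=> //; apply: TU_small.
Qed.

(** Minors with a repeated row vanish, and those with fewer than [n] rows belong to a proper subset,
    a tu-set; so only a maximal minor can violate total unimodularity. *)
Lemma te_lace_minor (n m : nat) (A : 'M[rat]_(n, m)) :
  te_lace A -> exists g : 'I_n -> 'I_m, \det (colsub g A) \notin [:: 0; 1; -1].
Proof.
case=> -[h1 h2 _] h3 h4.
have [/existsP[g hg]|/existsPn h0] :=
  boolP [exists g : {ffun 'I_n -> 'I_m}, \det (colsub g A) \notin [:: 0; 1; -1]].
  by exists g.
case: h3; split=> // k f g.
have [/injectiveP fI|/(det_noninj_rows A g)->] := boolP (injectiveb f); last by [].
have := leq_card f fI; rewrite !card_ord leq_eqVlt => /orP[/eqP kn|kn]; last first.
  have -> : mxsub f g A = mxsub id g (rowsub f A).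
    by apply/matrixP=> i j; rewrite !mxE.
  by have [_ _] := h4 k f fI kn; apply.
subst k; have {}h0 := h0 (finfun g); move: h0; rewrite negbK.
have -> : mxsub f g A = row_perm (perm fI) (colsub (finfun g) A).
  by apply/matrixP=> i j; rewrite !mxE permE ffunE.
rewrite row_permE det_mulmx det_perm -signr_odd.
case: (odd _); rewrite ?expr1 ?mulN1r ?expr0 ?mul1r //.
by rewrite !inE => /or3P[] /eqP ->; rewrite ?oppr0 ?opprK eqxx ?orbT.
Qed.

Lemma te_lace_lattice (n m : nat) (A : 'M[rat]_(n, m)) : te_lace A ->
  inL A (const_mx 2^-1) /\
  forall y, inL A y -> y \is a mxOver Num.int \/ y - const_mx 2^-1 \is a mxOver Num.int.
Proof.
move=> hA; have := te_lace_size hA; have [g hg] := te_lace_minor hA.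
case: hA => -[h1 h2 h3] h4 h5.
have ZA := pm1_int h1.
case: n A g hg h1 h2 h3 h4 h5 ZA => [//|[//|n]] A g hg h1 h2 h3 h4 h5 ZA _.
set B := colsub g A in hg.
have hd : \det B != 0 by apply: contraNneq hg => ->.
have hu : B \in unitmx by rewrite -det_neq0_unitmx.
have LB y : inL B y = inL A y by apply: inL_colsub.
pose b := \det B; pose C := invmx B.
have ZB : B \is a mxOver Num.int.
  by move/mxOverP: ZA => h; apply/mxOverP=> i j; rewrite mxE.
have tu i : tu_set (rowsub (lift i) A) by apply: h5 (ltnSn _); apply: lift_inj.
(* The rows other than [i] form a tu-set, and a lattice vector vanishing at [i] belongs to the
   lattice of that set. *)
have L0 i y : inL A y -> y 0 i = 0 -> y \is a mxOver Num.int.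
  move=> hy y0; have e : colsub (lift i) y *m rowsub (lift i) 1%:M = y.
    apply: rowsub_mul_inj; first exact: lift_inj.
    move=> l; case: (unliftP i l) => [k ->|->] //.
    by rewrite codom_f.
  have /mxOverP hc : colsub (lift i) y \is a mxOver Num.int.
    by apply: tu_set_inL (tu i) _; rewrite inL_rowsub e.
  apply/mxOverP=> a l; rewrite ord1; case: (unliftP i l) => [k ->|->].
    by have := hc 0 k; rewrite mxE.
  by rewrite y0 rpred0.
have L1 i y : inL A y -> y 0 i \is a Num.int -> y \is a mxOver Num.int.
  move=> hy hi; have /mxOverP h : y - y 0 i *: delta_mx 0 i \is a mxOver Num.int.
    apply: (@L0 i); last by rewrite !mxE !eqxx mulr1 subrr.
    apply: inLB => //; apply: inLZ => //; apply: inL_int => //.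
    by apply/mxOverP=> k l; rewrite mxE natr_int.
  apply/mxOverP=> k l; rewrite ord1.
  have -> : y 0 l = (y - y 0 i *: delta_mx 0 i) 0 l + y 0 i * (i == l)%:R.
    by rewrite !mxE eqxx [l == i]eq_sym subrK.
  by rewrite rpredD // rpredM ?natr_int.
have LC j : inL A (row j C) by rewrite -LB inL_row_invmx.
have bZ : b \is a Num.int by apply: det_int.
have Cb i j : b * C i j \in [:: 0; 1; -1].
  rewrite /C invmx_adj // !mxE mulVKf // /cofactor.
  have [_ _ /(_ _ id (g \o lift i))] := tu j.
  have -> : mxsub id (g \o lift i) (rowsub (lift j) A) = row' j (col' i B).
    by apply/matrixP=> u v; rewrite !mxE.
  rewrite -signr_odd; case: (odd _); rewrite ?expr1 ?mulN1r ?expr0 ?mul1r //.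
  by rewrite !inE => /or3P[] /eqP ->; rewrite ?oppr0 ?opprK eqxx ?orbT.
have rowC j : row j C != 0.
  apply/eqP=> h; have /rowP/(_ j) : row j C *m B = 0 by rewrite h mul0mx.
  by rewrite -row_mul mulVmx // !mxE eqxx => /eqP; rewrite oner_eq0.
(* If [b * x] were 1 or -1, the integer [b] would be 1 or -1, against the choice of [g]. *)
have nZ x : x \is a Num.int -> b * x \in [:: 0; 1; -1] -> x = 0.
  move=> xZ; rewrite !inE mulf_eq0 (negPf hd) /= => /or3P[/eqP //| |] /eqP e; exfalso.
    by move: hg; rewrite -/b; rewrite mulrC in e; case: (int_mul1 xZ bZ e) => ->.
  move: hg; have e1 : (- x) * b = 1 by rewrite mulNr mulrC e opprK.
  by rewrite -rpredN in xZ; rewrite -/b; case: (int_mul1 xZ bZ e1) => ->.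
(* A zero entry makes its whole row integral by [L0], hence zero by [nZ]. *)
have Cn i j : C i j != 0.
  apply/eqP=> h; have /mxOverP hZ : row i C \is a mxOver Num.int.
    by apply: (@L0 j); rewrite ?LC // mxE.
  case/eqP: (rowC i); apply/rowP=> k; rewrite !mxE; apply: nZ (Cb _ _).
  by have := hZ 0 k; rewrite mxE.
have Cs i j : b * C i j = 1 \/ b * C i j = -1.
  have := Cb i j; rewrite !inE mulf_eq0 (negPf hd) (negPf (Cn i j)) /=.
  by case/orP=> /eqP; auto.
have inj01 (e : rat) : row ord0 C != e *: row ord_max C.
  apply/eqP => /(congr1 (mulmxr B)) /=; rewrite -scalemxAl -!row_mul mulVmx // !row1.
  by move/rowP/(_ ord0); rewrite !mxE !eqxx /= mulr0 => /eqP; rewrite oner_eq0.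
(* Two rows of the inverse, with entries [b^-1] up to sign, agree somewhere and differ somewhere,
   being independent. By [L0] their difference is integral, and where they differ it is [2 / b] up
   to sign; so [b] divides 2. *)
have b2 : b = 2 \/ b = -2.
  have [i hi] : exists i, C ord0 i = C ord_max i.
    have [i /eqP hi|/= h0] := pickP (fun i => C ord0 i == C ord_max i); first by exists i.
    case/eqP: (inj01 (-1)); apply/rowP=> k; rewrite !mxE mulN1r.
    have := h0 k; apply: contraFeq => ne; apply/eqP/(mulfI hd).
    have : b * C ord0 k <> - (b * C ord_max k).
      by rewrite -mulrN => /(mulfI hd) /eqP; rewrite (negPf ne).
    by rewrite -/b; case: (Cs ord0 k) (Cs ord_max k) => -> [] ->; rewrite ?opprK.
  have /mxOverP hZ : row ord0 C - row ord_max C \is a mxOver Num.int.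
    by apply: (@L0 i); [apply: inLB | rewrite !mxE hi subrr].
  have [k hk] : exists k, C ord0 k != C ord_max k.
    have [k hk|/= h0] := pickP (fun i => C ord0 i != C ord_max i); first by exists k.
    case/eqP: (inj01 1); apply/rowP=> k; rewrite !mxE mul1r.
    by apply/eqP/negbFE/h0.
  have := hZ 0 k; rewrite !mxE => hx.
  have : (C ord0 k - C ord_max k) * b \in [:: 2; -2].
    have : b * C ord0 k != b * C ord_max k by rewrite (inj_eq (mulfI hd)).
    rewrite mulrBl ![_ * b]mulrC; case: (Cs ord0 k) (Cs ord_max k) => -> [] ->; rewrite ?eqxx //.
  set d := C ord0 k - C ord_max k in hx *.
  rewrite !inE => hin; have {hin} [z zZ zb] : exists2 z, z \is a Num.int & z * b = 2.
    case/orP: hin => /eqP e; first by exists d.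
    by exists (- d); rewrite ?rpredN // mulNr e opprK.
  case/orP: (half_or_odd bZ) => [hb|ob]; last first.
    by move: hg; rewrite -/b; case: (odd_int_mul2 zZ ob zb) => ->.
  have e : z * (2^-1 * b) = 1 by rewrite mulrCA zb; field.
  have b_half : b = 2 * (2^-1 * b) by rewrite mulVKf.
  by rewrite b_half; case: (int_mul1 zZ hb e) => ->; [left|right]; rewrite ?mulr1 ?mulrN1.
have Ch i j : odd_int (2 * C i j).
  have : 2 * C i j = 1 \/ 2 * C i j = -1.
    by case: b2 (Cs i j) => -> [] h; [left|right|right|left]; lra.
  by case=> ->; apply/odd_intP; [exists 0 | exists (-1)].
(* All entries of the inverse are congruent to 1/2 modulo 1, so [y] is congruent to the constant
   vector [z / 2], with [z] the sum of the entries of [y *m B]. *)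
have lat y : inL A y -> y \is a mxOver Num.int \/ y - const_mx 2^-1 \is a mxOver Num.int.
  move=> hy; have := hy; rewrite -LB => /mxOverP hw.
  pose z := \sum_j (y *m B) 0 j.
  have zZ : z \is a Num.int by rewrite rpred_sum.
  have yE k : y 0 k - 2^-1 * z \is a Num.int.
    rewrite -(mulmxK hu y) mxE mulr_sumr -sumrB rpred_sum // => j _.
    have -> : (y *m B) 0 j * invmx B j k - 2^-1 * (y *m B) 0 j =
      (y *m B) 0 j * (2^-1 * (2 * C j k - 1)) by rewrite /C; field.
    by rewrite rpredM //; apply: Ch.
  case/orP: (half_or_odd zZ) => hz; [left|right]; apply/mxOverP=> a k; rewrite ord1.
    by rewrite -[y 0 k](subrK (2^-1 * z)) rpredD.
  rewrite !mxE; have -> : y 0 k - 2^-1 = (y 0 k - 2^-1 * z) + 2^-1 * (z - 1) by field.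
  by rewrite rpredD.
split=> //; have [hC|/mxOverP hC] := lat _ (LC ord0).
  move/mxOverP/(_ 0 ord0): hC; rewrite mxE => h.
  by have := odd_int_half (Ch ord0 ord0); rewrite mulKf // h.
have -> : const_mx 2^-1 = row ord0 C - (row ord0 C - const_mx 2^-1).
  by rewrite opprB addrCA subrr addr0.
by apply: inLB => //; apply: inL_int => //; apply/mxOverP.
Qed.

(** * Half the root lattice D_n *)

(* Membership in (1/2) D_n. *)
Definition inD (n : nat) (y : 'rV[rat]_n) : bool :=
  [forall i, 2 * y 0 i \is a Num.int] && (\sum_i y 0 i \is a Num.int).

Lemma inDP (n : nat) (y : 'rV[rat]_n) :
  reflect ((forall i, 2 * y 0 i \is a Num.int) /\ \sum_i y 0 i \is a Num.int) (inD y).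
Proof. by apply: (iffP andP) => -[/forallP h1 h2]; split=> //; apply/forallP. Qed.

Lemma inDD (n : nat) (y z : 'rV[rat]_n) : inD y -> inD z -> inD (y + z).
Proof.
move=> /inDP[h1 h2] /inDP[h3 h4]; apply/inDP; split=> [i|].
  by rewrite mxE mulrDr rpredD.
by under eq_bigr do rewrite mxE; rewrite big_split rpredD.
Qed.

Lemma inDZ (n : nat) (c : rat) (y : 'rV[rat]_n) : c \is a Num.int -> inD y -> inD (c *: y).
Proof.
move=> cZ /inDP[h1 h2]; apply/inDP; split=> [i|].
  by rewrite mxE mulrCA rpredM.
by under eq_bigr do rewrite mxE; rewrite -mulr_sumr rpredM.
Qed.

Lemma inDN (n : nat) (y : 'rV[rat]_n) : inD y -> inD (- y).
Proof. by move=> h; rewrite -scaleN1r inDZ // rpredN1. Qed.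

Lemma inDB (n : nat) (y z : 'rV[rat]_n) : inD y -> inD z -> inD (y - z).
Proof. by move=> hy hz; apply: inDD => //; apply: inDN. Qed.

Lemma inD_int (n : nat) (y : 'rV[rat]_n) : y \is a mxOver Num.int -> inD y.
Proof. by move/mxOverP=> h; apply/inDP; split=> [i|]; rewrite ?rpredM ?rpred_sum. Qed.

Lemma sum_delta (n : nat) (i : 'I_n) (c : rat) : \sum_j c * (j == i)%:R = c.
Proof.
rewrite (bigD1 i) //= eqxx mulr1 big1 ?addr0 // => j /negPf ->.
by rewrite mulr0.
Qed.

Lemma inD_pair (n : nat) (i j : 'I_n) :
  inD (2^-1 *: (delta_mx 0 i + delta_mx 0 j)).
Proof.
apply/inDP; split=> [k|].
  by rewrite !mxE mulVKf //= rpredD ?natr_int.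
under eq_bigr do rewrite !mxE /= mulrDr; rewrite big_split /= !sum_delta.
by apply/intrP; exists 1; field.
Qed.

(** The rows [e_0] and [(e_0 + e_i) / 2] form a basis of half of the root lattice in dimension
    [n.+1]. *)
Definition basisD (n : nat) : 'M[rat]_n.+1 := \matrix_(i, j)
  (if i == ord0 then (j == ord0)%:R else 2^-1 * ((j == ord0)%:R + (j == i)%:R)).

Lemma det_basisD (n : nat) : \det (basisD n) = 2 ^- n.
Proof.
rewrite det_trig; last first.
  apply/is_trig_mxP=> i j ij; rewrite mxE.
  have -> : (j == ord0) = false by apply/negP=> /eqP e; move: ij; rewrite e.
  have -> : (j == i) = false by apply/negP=> /eqP e; move: ij; rewrite e ltnn.
  by case: eqP; rewrite // addr0 mulr0.
rewrite big_ord_recl mxE eqxx mul1r (eq_bigr (fun => 2^-1)).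
  by rewrite prodr_const card_ord exprVn.
by move=> i _; rewrite mxE eq_sym (negPf (neq_lift _ _)) eqxx /= add0r mulr1.
Qed.

Lemma basisD_coord (n : nat) (z : 'rV[rat]_n.+1) j : (z *m basisD n) 0 j =
  2^-1 * (z 0 j + (j == ord0)%:R * \sum_i z 0 i).
Proof.
rewrite mxE (eq_bigr (fun i => 2^-1 * z 0 i * (i == j)%:R +
   2^-1 * (j == ord0)%:R * z 0 i)); last first.
  move=> i _; rewrite !mxE [j == i]eq_sym; have [->|i0] := eqVneq i ord0; last by field.
  by rewrite [ord0 == j]eq_sym; field.
rewrite big_split /= -mulr_sumr (eq_bigr (fun i => 2^-1 * z 0 j * (i == j)%:R)).
  by rewrite sum_delta; ring.
by move=> i _; case: (eqVneq i j) => [->//|_]; rewrite !mulr0.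
Qed.

Lemma basisD_inD (n : nat) (z : 'rV[rat]_n.+1) :
  z \is a mxOver Num.int -> inD (z *m basisD n).
Proof.
move=> /mxOverP hz; apply/inDP; split=> [i|].
  by rewrite basisD_coord mulVKf // rpredD ?rpredM ?natr_int ?rpred_sum.
set S := \sum_i z 0 i; have hS : S \is a Num.int by rewrite rpred_sum.
rewrite (eq_bigr (fun j => 2^-1 * z 0 j + 2^-1 * S * (j == ord0)%:R)); last first.
  by move=> j _; rewrite basisD_coord -/S; ring.
rewrite big_split /= -mulr_sumr -/S sum_delta.
by have -> : 2^-1 * S + 2^-1 * S = S by field.
Qed.

Lemma inD_basisD (n : nat) (y : 'rV[rat]_n.+1) :
  inD y -> exists2 z, z \is a mxOver Num.int & y = z *m basisD n.
Proof.
move=> /inDP[h1 h2]; set S := \sum_i y 0 i in h2.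
(* This inverts [basisD_coord]: the entries of the witness sum to [2 * S - S = S]. *)
exists (\row_i (2 * y 0 i - (i == ord0)%:R * S)).
  by apply/mxOverP=> i j; rewrite mxE; apply: rpredB; rewrite ?h1 ?rpredM ?natr_int.
apply/rowP=> j; rewrite basisD_coord.
have -> : \sum_i (\row_i (2 * y 0 i - (i == ord0)%:R * S)) 0 i = S.
  rewrite (eq_bigr (fun j => 2 * y 0 j - S * (j == ord0)%:R)).
    by rewrite sumrB sum_delta -mulr_sumr -/S; ring.
  by move=> i _; rewrite mxE [S * _]mulrC.
by rewrite mxE; field.
Qed.

(** The lattice of [N] contains [Z^n] with index 2, so a single non-integral member generates the
    quotient. *)
Lemma index2_inL (n : nat) (N : 'M[rat]_n) (u y : 'rV[rat]_n) :
  N \is a mxOver Num.int -> \det N = 2 \/ \det N = -2 ->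
  inL N u -> u \isn't a mxOver Num.int -> inL N y ->
  exists2 z, z \is a Num.int & y - z *: u \is a mxOver Num.int.
Proof.
move=> hN hd hu nu hy.
have hd0 : \det N != 0 by case: hd => ->.
have hun : N \in unitmx by rewrite -det_neq0_unitmx.
have hu2 i : 2 * u 0 i \is a Num.int.
  have : u *m N *m \adj N \is a mxOver Num.int by apply: mxOverM => //; apply: adj_int.
  move/mxOverP/(_ 0 i); rewrite -mulmxA mul_mx_adj mul_mx_scalar mxE.
  by case: hd => -> //; rewrite mulNr rpredN.
have [i hi] : exists i, u 0 i \isn't a Num.int.
  have [i hi|/= h0] := pickP (fun i => u 0 i \isn't a Num.int); first by exists i.
  by case/negP: nu; apply/mxOverP=> a i; rewrite ord1; apply/negbFE/h0.
have [m hm] : exists m : int, u 0 i = 2^-1 + m%:~R.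
  case/orP: (half_or_odd (hu2 i)); first by rewrite mulKf // (negPf hi).
  move/odd_intP=> [m hm]; exists m; apply: (mulfI (_ : 2 != 0)) => //.
  by rewrite hm rmorphD rmorphM /=; field.
pose u' := u - m%:~R *: delta_mx 0 i.
have u'i : u' 0 i = 2^-1 by rewrite !mxE !eqxx hm /=; ring.
have hu' : inL N u'.
  apply: inLB => //; apply: inLZ; rewrite ?intr_int //; apply: inL_int => //.
  by apply/mxOverP=> a b; rewrite mxE natr_int.
(* The identity with row [i] replaced by [u'], of determinant 1/2. Its rows lie in the lattice and
   [P *m N] is unimodular, so [y] has integral coordinates in these rows. *)
pose P : 'M[rat]_n := \matrix_(l, k) (if l == i then u' 0 k else (l == k)%:R).
have dP : \det P = 2^-1.
  rewrite (expand_det_col _ i) (bigD1 i) //= big1 ?addr0; last first.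
    by move=> l li; rewrite mxE (negPf li) mul0r.
  rewrite mxE eqxx u'i /cofactor -signr_odd addnn odd_double expr0 mul1r.
  have -> : row' i (col' i P) = 1%:M; last by rewrite det1 mulr1.
  apply/matrixP=> a b; rewrite !mxE eq_sym (negPf (neq_lift _ _)).
  by rewrite (inj_eq lift_inj).
have hP : P \in unitmx by rewrite -det_neq0_unitmx dP.
have : inL (P *m N) (y *m invmx P) by rewrite /inL mulmxA mulmxKV.
move/unimodular_inL; set z := y *m invmx P => hz.
have {}hz : z \is a mxOver Num.int.
  apply: hz; last by rewrite det_mulmx dP; case: hd => ->; [left|right]; field.
  apply/mxOverP=> l k; have -> : (P *m N) l k = (row l P *m N) 0 k.
    by rewrite -row_mul [RHS]mxE.
  have [->|li] := eqVneq l i.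
    have -> : row i P = u' by apply/rowP=> b; rewrite !mxE eqxx.
    by move/mxOverP: hu'.
  have -> : row l P = delta_mx 0 l.
    by apply/rowP=> b; rewrite !mxE (negPf li) eq_sym.
  by rewrite -rowE mxE; move/mxOverP: hN.
have /mxOverP hz' := hz.
exists (z 0 i) => //; have -> : y = z *m P by rewrite mulmxKV.
apply/mxOverP=> a k; rewrite ord1.
have -> : (z *m P - z 0 i *: u) 0 k =
    \sum_(l | l != i) z 0 l * P l k - z 0 i * (m%:~R * (k == i)%:R).
  by rewrite !mxE (bigD1 i) //= !mxE !eqxx /=; ring.
rewrite rpredB ?rpredM ?natr_int ?intr_int // rpred_sum // => l li.
by rewrite [P l k]mxE (negPf li) rpredM ?natr_int.
Qed.

(** * Te-interlaces *)

(** The two rows form a te-lace of size 2, whose lattice contains (1/2, 1/2). *)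
Lemma te_interlace_pair (n m : nat) (A : 'M[rat]_(n, m)) i j :
  te_interlace A -> i != j -> inL A (2^-1 *: (delta_mx 0 i + delta_mx 0 j)).
Proof.
case=> _ _ h ij; have [] := te_lace_lattice (h i j ij); rewrite inL_rowsub => + _.
congr (inL A _); apply/rowP=> k; rewrite !mxE !big_ord_recl big_ord0 !mxE /=.
by rewrite /pair_idx /= ![k == _]eq_sym addr0 mulrDr.
Qed.

(** Half the sum of two rows is integral, so the rows agree modulo 2 in every column. *)
Lemma te_interlace_support (n m : nat) (A : 'M[rat]_(n, m)) i k j :
  te_interlace A -> A i j != 0 -> A k j = 1 \/ A k j = -1.
Proof.
move=> hA hij; have [[h1 _ _] _ _] := hA.
have [->|ki] := eqVneq k i.
  by have := h1 i j; rewrite !inE (negPf hij) /= => /orP[] /eqP; auto.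
have := h1 k j; rewrite !inE => /or3P[]/eqP e; [|by left|by right].
have /mxOverP/(_ 0 j) := te_interlace_pair hA ki.
rewrite -scalemxAl mulmxDl -!rowE !mxE e add0r.
have := h1 i j; rewrite !inE (negPf hij) /= => /orP[] /eqP ->.
  by rewrite mulr1 (negPf half_nint).
by rewrite mulrN1 rpredN (negPf half_nint).
Qed.

Lemma inL_half_delta (n m : nat) (A : 'M[rat]_(n, m)) i :
  pm1_mx A -> row_free A -> ~~ inL A (2^-1 *: delta_mx 0 i).
Proof.
move=> h1 h2; apply/negP=> /mxOverP h.
have r0 : row i A = 0.
  apply/rowP=> j; rewrite mxE [RHS]mxE; have := h 0 j; rewrite -scalemxAl -rowE !mxE.
  have := h1 i j; rewrite !inE => /or3P[] /eqP -> //.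
have /row_free_inj := h2 => /(_ 1 (delta_mx 0 i) 0).
rewrite -rowE r0 mul0mx => /(_ erefl) /rowP /(_ i).
by rewrite !mxE !eqxx => /eqP; rewrite oner_eq0.
Qed.

Lemma basisD_mul_int (n m : nat) (A : 'M[rat]_(n.+1, m)) :
  te_interlace A -> basisD n *m A \is a mxOver Num.int.
Proof.
move=> hA; have [[h1 _ _] _ _] := hA; apply/mxOverP=> i j.
have -> : (basisD n *m A) i j = (row i (basisD n) *m A) 0 j by rewrite -row_mul [RHS]mxE.
have [->|i0] := eqVneq i ord0.
  have -> : row ord0 (basisD n) = delta_mx 0 ord0 by apply/rowP=> k; rewrite !mxE.
  by rewrite -rowE mxE; have /mxOverP := pm1_int h1.
have -> : row i (basisD n) = 2^-1 *: (delta_mx 0 ord0 + delta_mx 0 i).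
  by apply/rowP=> k; rewrite !mxE (negPf i0).
have /mxOverP : inL A (2^-1 *: (delta_mx 0 ord0 + delta_mx 0 i)).
  by apply: te_interlace_pair; rewrite // eq_sym.
by apply.
Qed.

Lemma te_interlace_inD (n m : nat) (A : 'M[rat]_(n, m)) y :
  te_interlace A -> inD y -> inL A y.
Proof.
move=> hA; have := te_interlace_size hA; case: n A y hA => [//|n] A y hA _.
move/inD_basisD=> [z hz ->]; rewrite /inL -mulmxA mxOverM //.
exact: basisD_mul_int.
Qed.

(** The determinant of [basisD] cancels the equideterminant, so a column basis becomes unimodular in
    the coordinates of half of [D_n]. *)
Lemma thin_inL (n m : nat) (A : 'M[rat]_(n, m)) y :
  thin_te_interlace A -> inL A y = inD y.
Proof.
case=> hA [g hg]; apply/idP/idP; last exact: te_interlace_inD.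
have [[h1 _ h3] _ _] := hA.
have := te_interlace_size hA; case: n A y hA g hg h1 h3 => [//|n] A y hA g hg h1 h3 _ /= hy.
have hd : \det (colsub g A) != 0 by rewrite -normr_gt0 hg exprn_gt0.
have hu : basisD n \in unitmx.
  by rewrite -det_neq0_unitmx det_basisD invr_eq0 expf_neq0.
rewrite -(mulmxKV hu y); apply: basisD_inD.
apply: (@unimodular_inL _ (basisD n *m colsub g A)); last 1 first.
- by rewrite /inL mulmxA mulmxKV //; move: hy; rewrite -(inL_colsub _ h3 hd).
- rewrite mulmx_colsub; apply/mxOverP=> i j; rewrite mxE.
  by have /mxOverP := basisD_mul_int hA.
have : `|\det (basisD n *m colsub g A)| = 1.
  by rewrite det_mulmx normrM hg det_basisD normfV normrX ger0_norm // mulVf // expf_neq0.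
move/eqP; rewrite -[X in _ == X]normr1 eqr_norm2 => /orP[] /eqP; auto.
Qed.

(** In the coordinates of [basisD] a column basis has determinant 2 or -2, so [index2_inL]
    applies. *)
Lemma thick_coset (n m : nat) (A : 'M[rat]_(n, m)) : thick_te_interlace A ->
  exists v, [/\ inL A v, ~~ inD v, inD (2 *: v) &
    forall y, inL A y -> exists2 z, z \is a Num.int & inD (y - z *: v)].
Proof.
case=> hA [g hg].
have [[h1 _ h3] _ _] := hA.
have := te_interlace_size hA; case: n A hA g hg h1 h3 => [//|n] A hA g hg h1 h3 _ /=.
have hd : \det (colsub g A) != 0 by rewrite -normr_gt0 hg exprn_gt0.
have hu : basisD n \in unitmx.
  by rewrite -det_neq0_unitmx det_basisD invr_eq0 expf_neq0.
pose N := basisD n *m colsub g A.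
have hN : N \is a mxOver Num.int.
  rewrite /N mulmx_colsub; apply/mxOverP=> i j; rewrite mxE.
  by have /mxOverP := basisD_mul_int hA.
have dN : \det N = 2 \/ \det N = -2.
  have : `|\det N| = 2.
    rewrite det_mulmx normrM hg det_basisD normfV normrX ger0_norm // exprSr mulKf //.
    by rewrite expf_neq0.
  move/eqP; rewrite -[X in _ == X](@ger0_norm _ 2) // eqr_norm2 => /orP[] /eqP; auto.
have dN0 : \det N != 0 by case: dN => ->.
have LN y : inL N (y *m invmx (basisD n)) = inL A y.
  by rewrite -(inL_colsub _ h3 hd) /inL mulmxA mulmxKV.
(* The inverse of [N] has determinant 1/2 up to sign, so it has a non-integral row. *)
have [j hj] : exists j, row j (invmx N) \isn't a mxOver Num.int.
  have [j hj|/= h0] := pickP (fun j => row j (invmx N) \isn't a mxOver Num.int).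
    by exists j.
  exfalso; have : invmx N \is a mxOver Num.int.
    apply/mxOverP=> j k; have /negbFE/mxOverP/(_ 0 k) := h0 j.
    by rewrite mxE.
  move/det_int; rewrite det_inv; case: dN => ->; first by rewrite (negPf half_nint).
  by rewrite invrN rpredN (negPf half_nint).
pose u := row j (invmx N).
have uL : inL N u by apply: inL_row_invmx.
exists (u *m basisD n); split.
- by rewrite -LN mulmxK.
- apply: contra hj => /inD_basisD[z hz] /(congr1 (mulmxr (invmx (basisD n)))) /=.
  by rewrite !mulmxK // -/u => ->.
- rewrite scalemxAl; apply: basisD_inD; rewrite /u invmx_adj //; apply/mxOverP=> a k.
  rewrite mxE mxE mxE mulrA; apply: rpredM; last by have /mxOverP := adj_int hN.
  by case: dN => ->; [apply/intrP; exists 1|apply/intrP; exists (-1)]; rewrite /=; field.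
- move=> y; rewrite -LN => hy; have [z hz h] := index2_inL hN dN uL hj hy.
  exists z => //; rewrite -(mulmxKV hu y) scalemxAl -mulmxBl.
  exact: basisD_inD.
Qed.

Lemma half_nat_int (k : nat) : (2^-1 * k%:R : rat) \is a Num.int -> ~~ odd k.
Proof.
move=> h; apply/negP=> ok; have /negP := half_nint; apply.
have -> : 2^-1 = 2^-1 * k%:R - (k./2)%:R :> rat.
  have -> : k%:R = (k./2)%:R * 2 + 1 :> rat; last by field.
  by rewrite -natrM natr1; congr _%:R; lia.
by rewrite rpredB ?natr_int.
Qed.

Lemma odd_intD2 (x w : rat) : w \is a Num.int -> odd_int x -> odd_int (2 * w + x).
Proof.
rewrite /odd_int => hw hx; have -> : 2^-1 * (2 * w + x - 1) = w + 2^-1 * (x - 1) by field.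
by rewrite rpredD.
Qed.

Lemma sum_mul_rowsub1 (n k : nat) (f : 'I_k -> 'I_n) (y : 'rV[rat]_k) :
  \sum_l (y *m rowsub f 1%:M) 0 l = \sum_i y 0 i.
Proof.
under eq_bigr do rewrite mxE; rewrite exchange_big; apply: eq_bigr => i _ /=.
rewrite -[RHS](sum_delta (f i)); apply: eq_bigr => l _.
by rewrite !mxE eq_sym.
Qed.

Lemma inj_with_codom (n q : nat) (T : {set 'I_n}) : #|T| = q ->
  exists2 f : 'I_q -> 'I_n, injective f & forall i, (i \in codom f) = (i \in T).
Proof.
move=> <-; exists (@enum_val _ (mem T)); first exact: enum_val_inj.
move=> i; apply/codomP/idP => [[k ->]|hi]; first exact: enum_valP.
by exists (enum_rank_in hi i); rewrite enum_rankK_in.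
Qed.

Lemma inD_coset_even (n : nat) (v y : 'rV[rat]_n) z :
  inD (2 *: v) -> inD (y - z *: v) -> 2^-1 * z \is a Num.int -> inD y.
Proof.
move=> v2 hy hz; rewrite -(subrK (z *: v) y); apply: inDD => //.
have -> : z *: v = (2^-1 * z) *: (2 *: v) by rewrite scalerA; congr (_ *: _); field.
exact: inDZ.
Qed.

Lemma inD_coset_odd (n : nat) (v y : 'rV[rat]_n) z i :
  inD (y - z *: v) -> odd_int z -> odd_int (4 * v 0 i) -> odd_int (4 * y 0 i).
Proof.
move=> /inDP[/(_ i) d1 _] hz hv.
have -> : 4 * y 0 i = 2 * (2 * (y - z *: v) 0 i + 2^-1 * (z - 1) * (4 * v 0 i)) + 4 * v 0 i.
  by rewrite !mxE; field.
by apply: odd_intD2; rewrite // rpredD // rpredM // odd_int_int.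
Qed.

(** The rows in [S] together with row [t] form a row submatrix whose column basis satisfies the
    hypotheses of [partial_code_false]. *)
Lemma no_partial_coset (n m : nat) (A : 'M[rat]_(n, m)) (v : 'rV[rat]_n)
    (S : {set 'I_n}) s0 t :
  te_interlace A -> s0 \in S -> t \notin S -> inL A v -> inD (2 *: v) ->
  (forall i, i \in S -> odd_int (4 * v 0 i)) ->
  (forall i, i \notin S -> v 0 i = 0) ->
  (forall y, inL A y -> exists2 z, z \is a Num.int & inD (y - z *: v)) -> False.
Proof.
move=> hA s0S tS vL v2 vS vN hco.
have [[h1 h2 h3] _ _] := hA.
(* The numbers [2 * v 0 i] with [i] in [S] are halves of odd integers and their sum is integral, so
   [S] has even size; this makes [q] odd below. *)
have eS : ~~ odd #|S|.
  apply: half_nat_int; have /inDP[_] := v2.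
  rewrite (eq_bigr (fun i => 2 * v 0 i)) => [|i _]; last by rewrite mxE.
  move=> hs; have -> : 2^-1 * #|S|%:R =
      \sum_i 2 * v 0 i - \sum_(i in S) 2^-1 * (4 * v 0 i - 1).
    have -> : \sum_(i in S) 2^-1 * (4 * v 0 i - 1) = \sum_(i in S) (2 * v 0 i - 2^-1).
      by apply: eq_bigr => i _; field.
    rewrite sumrB sumr_const (bigID (mem S)) /= [X in _ + X - _]big1; last first.
      by move=> i hi; rewrite vN // mulr0.
    by rewrite addr0 opprB addrC subrK mulr_natr.
  by rewrite rpredB // rpred_sum // => i hi; apply: vS.
have [q oq cT] : exists2 q, odd q & #|t |: S| = q.+2.
  have : (0 < #|S|)%N by apply/card_gt0P; exists s0.
  by rewrite cardsU1 tS; move: eS; case: #|S| => [//|q] /=; rewrite negbK => oq _; exists q.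
have [f fI fT] := inj_with_codom cT.
have [t' Et] : exists t', t = f t' by apply/codomP; rewrite fT !inE eqxx.
have fS i : i != t' -> f i \in S.
  move=> it; have := codom_f f i; rewrite fT !inE Et (inj_eq fI).
  by rewrite (negPf it).
have rf : row_free (rowsub f A).
  apply: inj_row_free => y; rewrite rowsubE mulmxA => hy.
  have y0 : y *m rowsub f 1%:M = 0 by apply: (row_free_inj h2); rewrite mul0mx.
  by apply/rowP=> i; rewrite -(mul_rowsub1 y i fI) y0 !mxE.
have [g hg] := row_free_colsub rf.
have {}hg : \det (mxsub f g A) != 0.
  by move: hg; congr (\det _ != 0); apply/matrixP=> i j; rewrite !mxE.
apply: (@partial_code_false q (mxsub f g A) t') => //.
- exact: TE_mxsub.
- move=> i j; rewrite !mxE.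
  have [i' hi'|/= h0] := pickP (fun i => mxsub f g A i j != 0).
    by rewrite mxE in hi'; apply: te_interlace_support hi'.
  case/eqP: hg; rewrite (expand_det_col _ j) big1 // => k _.
  by have /negbFE/eqP -> := h0 k; rewrite mul0r.
- move=> y; rewrite inL_mxsub // inL_rowsub; set yy := y *m _ => hyy.
  have yE i : y 0 i = yy 0 (f i) by rewrite mul_rowsub1.
  have [z hz hd] := hco _ hyy.
  split.
    have /inDP[/(_ t) + _] := hd; rewrite yE -Et.
    have -> : (yy - z *: v) 0 t = yy 0 t - z * v 0 t.
      by clearbody yy; rewrite !mxE.
    by rewrite vN // mulr0 subr0.
  case/orP: (half_or_odd hz) => hz2; [left|right].
    have /inDP[e1 e2] := inD_coset_even v2 hd hz2.
    by split=> [i|]; [rewrite yE | rewrite -(sum_mul_rowsub1 f)].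
  by move=> i it; rewrite yE; apply: inD_coset_odd hd hz2 _; apply/vS/fS.
- have ev : colsub f v *m rowsub f 1%:M = v.
    apply: rowsub_mul_inj => // l; rewrite fT !inE negb_or => /andP[_]; exact: vN.
  exists (colsub f v); first by rewrite inL_mxsub // inL_rowsub ev.
  by move=> i it; rewrite mxE; apply/vS/fS.
Qed.

(** The set [S] of indices with [4 * v 0 i] odd is nonempty, since otherwise half a unit vector
    would lie in the lattice; it is everything by [no_partial_coset], after clearing [v] off [S]. *)
Lemma thick_coset_full (n m : nat) (A : 'M[rat]_(n, m)) : thick_te_interlace A ->
  exists v, [/\ inL A v, forall i, odd_int (4 * v 0 i), inD (2 *: v) &
    forall y, inL A y -> exists2 z, z \is a Num.int & inD (y - z *: v)].
Proof.
move=> hT; have [hA _] := hT; have [v [vL vN v2 hco]] := thick_coset hT.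
have [[h1 h2 _] _ _] := hA.
exists v; split=> //; pose S := [set i | odd_int (4 * v 0 i)].
have v4 i : 4 * v 0 i \is a Num.int.
  by have /inDP[/(_ i) + _] := v2; rewrite mxE mulrA.
have nS i : i \notin S -> 2 * v 0 i \is a Num.int.
  rewrite inE => hi; have := half_or_odd (v4 i); rewrite (negPf hi) orbF.
  by congr (_ \is a Num.int); field.
have [s0 s0S|S0] := pickP (mem S); last first.
  exfalso; have hv i : 2 * v 0 i \is a Num.int by apply: nS; have /= -> := S0 i.
  have /inDP[_] := v2; rewrite (eq_bigr (fun i => 2 * v 0 i)) => [|i _]; last by rewrite mxE.
  rewrite -mulr_sumr => /half_or_odd; rewrite mulKf // => /orP[h|ho].
    by case/negP: vN; apply/inDP.
  (* Here [v] has coordinates in (1/2)Z and a sum congruent to 1/2 modulo 1, so it differs from half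
     a unit vector by an element of half of [D_n]. *)
  have n0 : (0 < n)%N by apply: ltn_trans (te_interlace_size hA).
  have /negP := @inL_half_delta _ _ A (Ordinal n0) h1 h2; apply.
  set i0 := Ordinal n0; set e := 2^-1 *: _.
  rewrite -[e](subKr v); apply: inLB => //; apply: te_interlace_inD hA _.
  apply/inDP; split=> [i|].
    rewrite !mxE mulrBr rpredB // mulVKf //=; exact: natr_int.
  rewrite (eq_bigr (fun i => v 0 i - 2^-1 * (i == i0)%:R)) => [|i _]; last by rewrite !mxE.
  rewrite sumrB sum_delta;
  have -> : \sum_i v 0 i - 2^-1 = 2^-1 * (2 * \sum_i v 0 i - 1) by field.
  exact: ho.
move=> t; apply/negPn/negP=> tS.
have {}tS : t \notin S by rewrite inE.
(* [d] copies [v] off [S] and balances the sum to zero at [s0], so it lies in half of [D_n] and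
   [v - d] is supported on [S]. *)
pose d : 'rV[rat]_n := \row_l (if l \in S then
   (- \sum_(i | i \notin S) v 0 i) * (l == s0)%:R else v 0 l).
have s2 : 2 * \sum_(i | i \notin S) v 0 i \is a Num.int.
  by rewrite mulr_sumr rpred_sum.
have dD : inD d.
  apply/inDP; split=> [i|].
    rewrite mxE; case: ifPn => [_|/nS //].
    by rewrite mulrA mulrN rpredM ?natr_int // rpredN.
  rewrite (bigID (mem S)) /= (bigD1 s0) //= big1 => [|i /andP[iS is0]]; last first.
    by rewrite mxE iS (negPf is0) mulr0.
  rewrite mxE (_ : s0 \in S) // eqxx mulr1 addr0 addrC.
  rewrite (eq_bigr (fun i => v 0 i)) => [|i iS]; last by rewrite mxE (negPf iS).
  by rewrite subrr rpred0.
apply: (@no_partial_coset _ _ A (v - d) S s0 t) => //.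
- by apply: inLB => //; apply: te_interlace_inD.
- by rewrite scalerBr; apply: inDB => //; apply: inDZ.
- move=> i iS; rewrite !mxE iS.
  have -> : 4 * (v 0 i - (- \sum_(j | j \notin S) v 0 j) * (i == s0)%:R) =
    2 * ((2 * \sum_(j | j \notin S) v 0 j) * (i == s0)%:R) + 4 * v 0 i by ring.
  by apply: odd_intD2; [rewrite rpredM ?natr_int | rewrite inE in iS].
- by move=> i iS; rewrite !mxE (negPf iS) subrr.
- move=> y /hco[z hz hy]; exists z => //.
  have -> : y - z *: (v - d) = (y - z *: v) + z *: d by rewrite scalerBr opprB addrA addrAC.
  by apply: inDD => //; apply: inDZ.
Qed.

Lemma thick_inL (n m : nat) (A : 'M[rat]_(n, m)) y : thick_te_interlace A ->
  inL A y -> inD y \/ forall i, odd_int (4 * y 0 i).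
Proof.
move=> hT hy; have [v [vL vo v2 hco]] := thick_coset_full hT.
have [z hz hd] := hco _ hy.
case/orP: (half_or_odd hz) => hz2; [left|right]; first exact: inD_coset_even hd hz2.
by move=> i; apply: inD_coset_odd hd hz2 _.
Qed.

(** Each [2 * v 0 i] is half an odd integer, and their sum over all [n] indices is integral. *)
Lemma thick_even (n m : nat) (A : 'M[rat]_(n, m)) : thick_te_interlace A -> ~~ odd n.
Proof.
move=> /thick_coset_full[v [_ vo /inDP[_ v2] _]]; apply: half_nat_int.
have -> : 2^-1 * n%:R = \sum_i (2 *: v) 0 i - \sum_i 2^-1 * (4 * v 0 i - 1).
  rewrite -sumrB (eq_bigr (fun=> 2^-1)) => [|i _]; last by rewrite mxE; field.
  by rewrite sumr_const card_ord mulr_natr.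
by rewrite rpredB // rpred_sum // => i _; apply: vo.
Qed.

(** A 2 by 2 minor with entries 0, 1, -1 has absolute value at most 2, while a thick pair would need
    4. *)
Lemma thick_size (n m : nat) (A : 'M[rat]_(n, m)) : thick_te_interlace A -> (2 < n)%N.
Proof.
move=> [hA [g hg]]; rewrite ltn_neqAle (te_interlace_size hA) andbT; apply/eqP=> n2.
subst n; have [[h1 _ _] _ _] := hA.
have n1 i j : `|A i j| <= 1 by have := h1 i j; rewrite !inE => /or3P[] /eqP ->.
move: hg; rewrite (expand_det_row _ ord0).
rewrite !big_ord_recl big_ord0 /cofactor !det_mx11 !mxE /=.
set a := A _ _; set b := A _ _; set c := A _ _; set d := A _ _.
have [ha hb hc hd] : [/\ `|a| <= 1, `|b| <= 1, `|c| <= 1 & `|d| <= 1].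
  by split; apply: n1.
rewrite expr0 expr1 mul1r mulN1r mulrN addr0.
have : `|a * b - c * d| <= 2.
  apply: le_trans (ler_normB _ _) _; rewrite !normrM.
  have -> : (2 : rat) = 1 * 1 + 1 * 1 by [].
  by rewrite lerD // ler_pM.
by move=> + e; rewrite e.
Qed.

(** Subtracting the constant 1/4 from [v] leaves coordinates in (1/2)Z. Their sum is integral, or
    becomes so after subtracting half a unit vector; the result then lies in half of [D_n]. *)
Lemma thick_center (n m : nat) (A : 'M[rat]_(n, m)) : thick_te_interlace A ->
  inL A (const_mx 4^-1) \/ forall i, inL A (const_mx 4^-1 + 2^-1 *: delta_mx 0 i).
Proof.
move=> hT; have [hA _] := hT; have [v [vL vo /inDP[_ v2] _]] := thick_coset_full hT.
have h2 i : 2 * (v - const_mx 4^-1) 0 i \is a Num.int.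
  have -> : 2 * (v - const_mx 4^-1) 0 i = 2^-1 * (4 * v 0 i - 1) by rewrite !mxE; field.
  exact: vo.
have : 2 * \sum_i (v - const_mx 4^-1) 0 i \is a Num.int.
  by rewrite mulr_sumr rpred_sum.
move/half_or_odd; rewrite mulKf // => /orP[h|h]; [left|right].
  rewrite -[const_mx _](subKr v); apply: inLB => //; apply: te_interlace_inD => //.
  exact/inDP.
move=> i; rewrite -[X in inL A X](subKr v); apply: inLB => //; apply: te_interlace_inD => //.
apply/inDP; split=> [k|].
  have -> : 2 * (v - (const_mx 4^-1 + 2^-1 *: delta_mx 0 i)) 0 k =
    2 * (v - const_mx 4^-1) 0 k - (k == i)%:R by rewrite !mxE /=; field.
  by rewrite rpredB ?natr_int.
rewrite (eq_bigr (fun k => (v - const_mx 4^-1) 0 k - 2^-1 * (k == i)%:R)); last first.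
  by move=> k _; rewrite !mxE /=; field.
rewrite sumrB sum_delta; set s := \sum_i _ in h *.
by have -> : s - 2^-1 = 2^-1 * (2 * s - 1) by field.
Qed.

(** * Column counts of thick te-interlaces *)

Lemma count_col_sum (n m : nat) (A : 'M[rat]_(n, m)) j : pm1_mx A ->
  \sum_i A i j = (count_col A j 1)%:R - (count_col A j (-1))%:R.
Proof.
move=> hA; rewrite /count_col -!sum1dep_card !natr_sum
  [X in X - _]big_mkcond [X in _ - X]big_mkcond /= -sumrB.
apply: eq_bigr => i _ /=; have := hA i j; rewrite !inE => /or3P[] /eqP -> //=.
Qed.

Lemma count_col_size (n m : nat) (A : 'M[rat]_(n, m)) j : te_interlace A ->
  col j A != 0 -> (count_col A j 1 + count_col A j (-1) = n)%N.
Proof.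
move=> hA hj.
have [i hi] : exists i, A i j != 0.
  have [i hi|/= h0] := pickP (fun i => A i j != 0); first by exists i.
  by case/eqP: hj; apply/colP=> k; rewrite !mxE; apply/eqP/negbFE/h0.
rewrite /count_col -!sum1dep_card [X in (X + _)%N]big_mkcond
  [X in (_ + X)%N]big_mkcond -big_split /=.
rewrite (eq_bigr (fun=> 1%N)) ?sum_nat_const ?card_ord ?muln1 // => k _.
by case: (te_interlace_support k hA hi) => ->.
Qed.

Lemma const_mul_col (n m : nat) (A : 'M[rat]_(n, m)) c j :
  ((const_mx c : 'rV_n) *m A) 0 j = c * \sum_i A i j.
Proof. by rewrite mxE mulr_sumr; apply: eq_bigr => i _; rewrite mxE. Qed.

(** With [a] ones and [b] minus ones, integrality makes [a - b] divisible by 4 and full support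
    gives [a + b = n], so both counts are congruent to [n / 2] modulo 2. *)
Lemma count_col_center (n m : nat) (A : 'M[rat]_(n, m)) j :
  thick_te_interlace A -> inL A (const_mx 4^-1) -> col j A != 0 ->
  odd (count_col A j 1) = odd n./2 /\ odd (count_col A j (-1)) = odd n./2.
Proof.
move=> hT /mxOverP/(_ 0 j); have hn := thick_even hT; have [hA _] := hT.
have [[h1 _ _] _ _] := hA; rewrite const_mul_col count_col_sum //.
move=> hc /(count_col_size hA).
move: (count_col A j 1) (count_col A j (-1)) hc => a b /intrP[z e] en.
have {}e : (a%:Z - b%:Z = 4 * z).
  by apply: (@intr_inj rat); rewrite rmorphB rmorphM /= -e; field.
by split; lia.
Qed.

(** The extra half row makes [a - b] congruent to 2 modulo 4, which flips both parities. *)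
Lemma count_col_off_center (n m : nat) (A : 'M[rat]_(n, m)) i j :
  thick_te_interlace A -> inL A (const_mx 4^-1 + 2^-1 *: delta_mx 0 i) ->
  col j A != 0 ->
  odd (count_col A j 1) = ~~ odd n./2 /\ odd (count_col A j (-1)) = ~~ odd n./2.
Proof.
move=> hT /mxOverP/(_ 0 j); have hn := thick_even hT; have [hA _] := hT.
have [[h1 _ _] _ _] := hA; rewrite mulmxDl mxE const_mul_col count_col_sum //.
rewrite -scalemxAl -rowE !mxE => hc hj.
have en := count_col_size hA hj.
have hi : A i j = 1 \/ A i j = -1.
  have [k hk|/= h0] := pickP (fun i => A i j != 0).
    exact: te_interlace_support hk.
  by case/eqP: hj; apply/colP=> k; rewrite !mxE; apply/eqP/negbFE/h0.
move: (count_col A j 1) (count_col A j (-1)) hc en => a b /intrP[z e] en.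
have {}e : (a%:Z - b%:Z + 2 = 4 * z) \/ (a%:Z - b%:Z - 2 = 4 * z).
  by case: hi e => -> e; [left|right]; apply: (@intr_inj rat);
    rewrite ?rmorphB ?rmorphD ?rmorphM ?rmorphB /= -e; field.
by case: e => e; split; lia.
Qed.

(** * Recognizing a Hilbert basis in coordinates *)

Lemma le_sum_eq (n : nat) (l l' : 'rV[rat]_n) : (forall i, l 0 i <= l' 0 i) ->
  \sum_i l 0 i = \sum_i l' 0 i -> l = l'.
Proof.
move=> h e; apply/rowP=> i; apply/eqP; rewrite eq_sym -subr_eq0; apply/eqP.
have /psumr_eq0P : \sum_i (l' 0 i - l 0 i) = 0 by rewrite sumrB e subrr.
by apply=> // k _; rewrite subr_ge0.
Qed.

Lemma nonneg_int_comb0 (m : nat) (H : {fset 'rV[rat]_m}) : nonneg_int_comb H 0.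
Proof. by exists (fun=> 0%N); rewrite big1. Qed.

Lemma nonneg_int_combD (m : nat) (H : {fset 'rV[rat]_m}) x y :
  nonneg_int_comb H x -> nonneg_int_comb H y -> nonneg_int_comb H (x + y).
Proof.
move=> [c ->] [d ->]; exists (fun h => c h + d h)%N.
by rewrite -big_split; apply: eq_bigr => h _; rewrite mulrnDr.
Qed.

Lemma nonneg_int_comb1 (m : nat) (H : {fset 'rV[rat]_m}) h :
  h \in H -> nonneg_int_comb H h.
Proof.
move=> hH; exists (fun g => (g == h) : nat).
rewrite (bigD1_seq h) //= ?fset_uniq // eqxx mulr1n big1 ?addr0 //.
by move=> g /negPf ->.
Qed.

(* [T] is the set of coordinate vectors of [H]. It is an antichain for the
   componentwise order, and a nonnegative combination lies above each of its
   terms: no element of [H] is a combination of the others. *)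
Lemma hilbert_basis_criterion (n m : nat) (A : 'M[rat]_(n, m))
    (H : {fset 'rV[rat]_m}) (T : 'rV[rat]_n -> Prop) :
  row_free A ->
  (forall x, x \in H <-> exists2 l, T l & x = l *m A) ->
  (forall l, T l -> (forall i, 0 <= l 0 i) /\ inL A l) ->
  (forall P : 'rV[rat]_n -> Prop, P 0 -> (forall x y, P x -> P y -> P (x + y)) ->
    (forall l, T l -> P l) ->
    forall l : 'rV_n, (forall i, 0 <= l 0 i) -> inL A l -> P l) ->
  (forall l l', T l -> T l' -> (forall i, l 0 i <= l' 0 i) -> l = l') ->
  ~ T 0 ->
  is_hilbert_basis A H.
Proof.
move=> hA hT hpos hgen hanti h0; split.
  split=> [h /hT[l Tl ->]|x /int_vecP xZ [l l0 e]].
    have [l0 lL] := hpos _ Tl; split; last by exists l.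
    exact/int_vecP.
  rewrite {x}e in xZ *; apply: (hgen (fun l => nonneg_int_comb H (l *m A))) => //.
  - by rewrite mul0mx; apply: nonneg_int_comb0.
  - by move=> y z hy hz; rewrite mulmxDl; apply: nonneg_int_combD.
  - by move=> k Tk; apply: nonneg_int_comb1; apply/hT; exists k.
move=> H'; rewrite fproperE => /andP[sub /fsubsetPn[h hH hH']] [h1 h2].
have /hT[l Tl e] := hH; have [l0 lL] := hpos _ Tl.
have [c ec] : nonneg_int_comb H' h.
  by apply: h2; [rewrite e; apply/int_vecP | exists l].
(* [A] is row free, so [pinvmx A] recovers coordinates. *)
have KA (k : 'rV_n) : k *m A *m pinvmx A = k by apply: mulmxKp.
have [g gH' cg] : exists2 g, g \in H' & c g != 0%N.
  have [/hasP[g g1 g2]|/hasPn hn] := boolP (has (fun g => c g != 0%N) H').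
    by exists g.
  case: h0; have hz : h = 0.
    by rewrite ec big_seq big1 // => g /hn /negPn/eqP ->.
  by rewrite (_ : 0 = l) // -(KA l) -e hz mul0mx.
have /hT[k Tk ek] : g \in H by apply: (fsubsetP sub).
have : k = l.
  apply: hanti => // i; rewrite -[l]KA -e ec mulmx_suml summxE big_seq.
  rewrite (eq_bigr (fun g => (g *m pinvmx A) 0 i *+ c g)); last first.
    by move=> x _; rewrite -scaler_nat -scalemxAl mxE mulr_natl.
  rewrite -big_seq (bigD1_seq g) //= ?fset_uniq //.
  rewrite (_ : g *m pinvmx A = k) ?ek ?KA // -ek -[X in X <= _]addr0.
  apply: lerD.
    by case: (c g) cg => // q _; rewrite mulrS lerDl mulrn_wge0 //; case: (hpos _ Tk).
  rewrite big_seq_cond sumr_ge0 // => x /andP[xH _]; rewrite mulrn_wge0 //.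
  have /hT[k' Tk' ->] : x \in H by apply: (fsubsetP sub).
  by rewrite KA; case: (hpos _ Tk').
by move=> kl; case/negP: hH'; rewrite e -kl -ek.
Qed.

(** * Hilbert bases *)

Definition is_unit_vec (n : nat) (l : 'rV[rat]_n) : Prop := exists i, l = delta_mx 0 i.

Definition is_half_pair (n : nat) (l : 'rV[rat]_n) : Prop :=
  exists i j, i != j /\ l = 2^-1 *: (delta_mx 0 i + delta_mx 0 j).

Definition is_off_center (n : nat) (l : 'rV[rat]_n) : Prop :=
  exists i, l = const_mx 4^-1 + 2^-1 *: delta_mx 0 i.

Lemma rows_setP (n m : nat) (A : 'M[rat]_(n, m)) x :
  x \in rows_set A <-> exists2 l, is_unit_vec l & x = l *m A.
Proof.
split=> [/imfsetP[i _ ->]|[l [i ->] ->]] /=.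
  by exists (delta_mx 0 i); [exists i | rewrite rowE].
by apply/imfsetP; exists i; rewrite // rowE.
Qed.

Lemma half_pairsP (n m : nat) (A : 'M[rat]_(n, m)) x :
  x \in half_pairs A <-> exists2 l, is_half_pair l & x = l *m A.
Proof.
have E i j : 2^-1 *: (delta_mx 0 i + delta_mx 0 j) *m A = 2^-1 *: (row i A + row j A).
  by rewrite -scalemxAl mulmxDl -!rowE.
split=> [/imfset2P[i _ [j]]|[l [i [j [ij ->]]] ->]] /=.
  rewrite inE => ij ->; exists (2^-1 *: (delta_mx 0 i + delta_mx 0 j)); last by rewrite E.
  by exists i, j; split=> //; apply: contraTneq ij => ->; rewrite ltnn.
rewrite E; apply/imfset2P; case: (ltngtP i j) => [lt|lt|/val_inj e].
- by exists i => //; exists j.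
- by exists j => //; exists i; rewrite // addrC.
- by rewrite e eqxx in ij.
Qed.

Lemma const_mulmx (n m : nat) (A : 'M[rat]_(n, m)) c : const_mx c *m A = c *: sum_rows A.
Proof.
apply/rowP=> j; rewrite const_mul_col mxE; congr (_ * _).
by rewrite /sum_rows summxE; apply: eq_bigr => i _; rewrite mxE.
Qed.

Lemma three_quarter_setP (n m : nat) (A : 'M[rat]_(n, m)) x :
  x \in three_quarter_set A <-> exists2 l, is_off_center l & x = l *m A.
Proof.
have E i : (const_mx 4^-1 + 2^-1 *: delta_mx 0 i) *m A =
   (3%:R / 4%:R) *: row i A + 4^-1 *: \sum_(j < n | j != i) row j A.
  rewrite mulmxDl const_mulmx -scalemxAl -rowE /sum_rows (bigD1 i) //= scalerDr.
  by rewrite addrAC -scalerDl; congr (_ *: _ + _); field.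
split=> [/imfsetP[i _ ->]|[l [i ->] ->]] /=.
  by exists (const_mx 4^-1 + 2^-1 *: delta_mx 0 i); [exists i | rewrite E].
by apply/imfsetP; exists i; rewrite // E.
Qed.

Lemma unit_vec_ge0 (n : nat) (l : 'rV[rat]_n) i : is_unit_vec l -> 0 <= l 0 i.
Proof. by case=> j ->; rewrite mxE ler0n. Qed.

Lemma half_pair_ge0 (n : nat) (l : 'rV[rat]_n) i : is_half_pair l -> 0 <= l 0 i.
Proof. by case=> j [k [_ ->]]; rewrite !mxE mulr_ge0 // addr_ge0 ?ler0n. Qed.

Lemma off_center_ge (n : nat) (l : 'rV[rat]_n) i : is_off_center l -> 4^-1 <= l 0 i.
Proof. by case=> j ->; rewrite !mxE lerDl mulr_ge0 ?ler0n. Qed.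

Lemma unit_vec_sum (n : nat) (l : 'rV[rat]_n) : is_unit_vec l -> \sum_i l 0 i = 1.
Proof.
case=> j ->; rewrite (eq_bigr (fun i => 1 * (i == j)%:R)) ?sum_delta // => i _.
by rewrite !mxE mul1r.
Qed.

Lemma half_pair_sum (n : nat) (l : 'rV[rat]_n) : is_half_pair l -> \sum_i l 0 i = 1.
Proof.
case=> j [k [_ ->]].
rewrite (eq_bigr (fun i => 2^-1 * (i == j)%:R + 2^-1 * (i == k)%:R)) => [|i _].
  by rewrite big_split /= !sum_delta; field.
by rewrite !mxE mulrDr.
Qed.

Lemma off_center_sum (n : nat) (l : 'rV[rat]_n) : is_off_center l ->
  \sum_i l 0 i = 4^-1 * n%:R + 2^-1.
Proof.
case=> j ->; rewrite (eq_bigr (fun i => 4^-1 + 2^-1 * (i == j)%:R)) => [|i _].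
  by rewrite big_split /= sum_delta sumr_const card_ord mulr_natr.
by rewrite !mxE.
Qed.

Lemma unit_vec_zero (n : nat) (l : 'rV[rat]_n) : (1 < n)%N -> is_unit_vec l ->
  exists k, l 0 k = 0.
Proof.
move=> n1 [i ->]; have : ~~ ([set: 'I_n] \subset [set i]).
  by apply: contraL n1 => /subset_leq_card; rewrite cardsT card_ord cards1 -leqNgt.
case/subsetPn=> k _; rewrite inE => ki; exists k.
by rewrite mxE (negPf ki).
Qed.

Lemma half_pair_zero (n : nat) (l : 'rV[rat]_n) : (2 < n)%N -> is_half_pair l ->
  exists k, l 0 k = 0.
Proof.
move=> n2 [i [j [ij ->]]]; have : ~~ ([set: 'I_n] \subset [set i; j]).
  by apply: contraL n2 => /subset_leq_card; rewrite cardsT card_ord cards2 ij -leqNgt.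
case/subsetPn=> k _; rewrite !inE negb_or => /andP[ki kj]; exists k.
by rewrite !mxE (negPf ki) (negPf kj) addr0 mulr0.
Qed.

Lemma unit_vec_one (n : nat) (l : 'rV[rat]_n) : is_unit_vec l -> exists i, l 0 i = 1.
Proof. by case=> i ->; exists i; rewrite !mxE !eqxx. Qed.

Lemma off_center_lt1 (n : nat) (l : 'rV[rat]_n) i : is_off_center l -> l 0 i < 1.
Proof. by case=> j ->; rewrite !mxE /=; case: (i == j); rewrite /= ?mulr1 ?mulr0. Qed.

Lemma half_pair_half (n : nat) (l : 'rV[rat]_n) : is_half_pair l ->
  exists i j, [/\ i != j, l 0 i = 2^-1 & l 0 j = 2^-1].
Proof.
case=> i [j [ij ->]]; exists i, j; rewrite !mxE !eqxx (negPf ij) eq_sym (negPf ij) /=.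
by rewrite addr0 add0r mulr1.
Qed.

Lemma row_nat_ind (n : nat) (P : 'rV[rat]_n -> Prop) : P 0 ->
  (forall x y, P x -> P y -> P (x + y)) -> (forall l, is_unit_vec l -> P l) ->
  forall l : 'rV_n, (forall i, 0 <= l 0 i) -> l \is a mxOver Num.int -> P l.
Proof.
move=> P0 PD PT l l0 /mxOverP lZ; rewrite (row_sum_delta l).
apply: big_ind => // i _; have := lZ 0 i; rewrite intrEge0 // => /natrP[k ->].
rewrite scaler_nat; elim: k => [|k IHk]; first by rewrite mulr0n.
by rewrite mulrS; apply: PD => //; apply: PT; exists i.
Qed.

Lemma half_int_cases (x : rat) : 2 * x \is a Num.int -> 0 <= x -> [\/ x = 0, x = 2^-1 | 1 <= x].
Proof.
move=> h x0; have h0 : 0 <= 2 * x by rewrite mulr_ge0.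
move: h; rewrite intrEge0 // => /natrP[[|[|k]] e].
- by apply: Or31; move: e; rewrite mulr0n; lra.
- by apply: Or32; move: e; rewrite mulr1n; lra.
- apply: Or33; have : (0 : rat) <= k%:R by rewrite ler0n.
  by move: e; rewrite -addn2 natrD; lra.
Qed.

(** Induction on the integral coordinate sum: a nonzero vector dominates a unit vector or a
    half-pair, each of sum 1. If no coordinate reaches 1, all are 0 or 1/2, and the integral sum
    forces two halves. *)
Lemma inD_nonneg_ind (n : nat) (P : 'rV[rat]_n -> Prop) : P 0 ->
  (forall x y, P x -> P y -> P (x + y)) ->
  (forall l, is_unit_vec l \/ is_half_pair l -> P l) ->
  forall l : 'rV_n, (forall i, 0 <= l 0 i) -> inD l -> P l.
Proof.
move=> P0 PD PT l l0 lD; have /inDP[_] := lD.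
rewrite intrEge0 ?sumr_ge0 // => /natrP[k]; elim: k l l0 lD => [|k IHk] l l0 lD e.
  suff -> : l = 0 by [].
  by apply/esym/le_sum_eq => [i|]; rewrite ?mxE // e big1 // => i _; rewrite mxE.
have /inDP[l2 _] := lD.
have step h : is_unit_vec h \/ is_half_pair h -> (forall i, h 0 i <= l 0 i) -> P l.
  move=> hT hl; rewrite -(subrK h l); apply: PD; last exact: PT.
  apply: IHk => [i||].
  - by rewrite !mxE subr_ge0.
  - apply: inDB => //; case: hT => [[i ->]|[i [j [_ ->]]]]; last exact: inD_pair.
    by apply: inD_int; apply/mxOverP=> a b; rewrite mxE natr_int.
  - rewrite (eq_bigr (fun i => l 0 i - h 0 i)) => [|i _]; last by rewrite !mxE.
    rewrite sumrB e; have -> : \sum_i h 0 i = 1.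
      by case: hT; [apply: unit_vec_sum | apply: half_pair_sum].
    by rewrite -addn1 natrD addrK.
have [i hi|/= h1] := pickP (fun i => 1 <= l 0 i).
  apply: (step (delta_mx 0 i)); first by left; exists i.
  move=> k'; rewrite mxE eqxx /=; case: eqP => [->|_] //.
have lc i : l 0 i = 0 \/ l 0 i = 2^-1.
  by case: (half_int_cases (l2 i) (l0 i)) => [||h]; [left|right|have := h1 i; rewrite h].
have [i hi] : exists i, l 0 i = 2^-1.
  have [i /eqP hi|/= hn] := pickP (fun i => l 0 i == 2^-1); first by exists i.
  move: e; rewrite big1 => [/eqP|i _]; first by rewrite eq_sym pnatr_eq0.
  by case: (lc i) => // /eqP; rewrite hn.
have [j ij hj] : exists2 j, i != j & l 0 j = 2^-1.
  have [j /andP[h /eqP hj]|/= hn] := pickP (fun j => (i != j) && (l 0 j == 2^-1)).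
    by exists j.
  move: e; rewrite (bigD1 i) //= big1 => [|j ji].
    rewrite hi addr0 => h; have /negP := half_nint; case; rewrite h; exact: natr_int.
  by case: (lc j) => // /eqP h; have := hn j; rewrite eq_sym ji h.
apply: (step (2^-1 *: (delta_mx 0 i + delta_mx 0 j))); first by right; exists i, j.
move=> k'; rewrite !mxE eqxx /=; have [->|ki] := eqVneq k' i.
  by rewrite (negPf ij) hi addr0 mulr1.
by case: eqP => [->|_]; rewrite ?hj add0r ?mulr1 ?mulr0.
Qed.

Local Open Scope fset_scope.

Lemma inL_unit_vec (n m : nat) (A : 'M[rat]_(n, m)) l :
  pm1_mx A -> is_unit_vec l -> inL A l.
Proof.
move=> /pm1_int hA [i ->]; apply: inL_int => //.
by apply/mxOverP=> a b; rewrite mxE natr_int.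
Qed.

Definition is_unit_or_pair (n : nat) (l : 'rV[rat]_n) : Prop :=
  is_unit_vec l \/ is_half_pair l.

Lemma unit_or_pair_ge0 (n : nat) (l : 'rV[rat]_n) i : is_unit_or_pair l -> 0 <= l 0 i.
Proof. by case; [apply: unit_vec_ge0 | apply: half_pair_ge0]. Qed.

Lemma unit_or_pair_sum (n : nat) (l : 'rV[rat]_n) : is_unit_or_pair l -> \sum_i l 0 i = 1.
Proof. by case; [apply: unit_vec_sum | apply: half_pair_sum]. Qed.

Lemma unit_or_pair_zero (n : nat) (l : 'rV[rat]_n) : (2 < n)%N -> is_unit_or_pair l ->
  exists k, l 0 k = 0.
Proof. by move=> n2; case; [apply/unit_vec_zero/ltnW | apply: half_pair_zero]. Qed.

Lemma unit_or_pair_inL (n m : nat) (A : 'M[rat]_(n, m)) l :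
  te_interlace A -> is_unit_or_pair l -> inL A l.
Proof.
move=> hA [h|[i [j [ij ->]]]]; last exact: te_interlace_pair.
by apply: inL_unit_vec h; case: hA => -[].
Qed.

Lemma rows_half_pairsP (n m : nat) (A : 'M[rat]_(n, m)) x :
  x \in rows_set A `|` half_pairs A <-> exists2 l, is_unit_or_pair l & x = l *m A.
Proof.
rewrite in_fsetU; split=> [/orP[/rows_setP|/half_pairsP] [l h e]|[l [h|h] e]].
- by exists l => //; left.
- by exists l => //; right.
- by apply/orP; left; apply/rows_setP; exists l.
- by apply/orP; right; apply/half_pairsP; exists l.
Qed.

(** * The Hilbert bases of the kinds of te-bricks *)

Lemma tu_hilbert_basis (n m : nat) (A : 'M[rat]_(n, m)) :
  tu_set A -> is_hilbert_basis A (rows_set A).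
Proof.
move=> hA; have [h1 h2 _] := hA.
apply: (hilbert_basis_criterion h2 (rows_setP A)).
- by move=> l hl; split=> [i|]; [apply: unit_vec_ge0 | apply: inL_unit_vec].
- by move=> P P0 PD PT l l0 /(tu_set_inL hA); apply: row_nat_ind.
- by move=> l l' h h' hle; apply: le_sum_eq => //; rewrite !unit_vec_sum.
- by move/unit_vec_one=> [i /eqP]; rewrite mxE eq_sym oner_eq0.
Qed.

Lemma lace_hilbert_basis (n m : nat) (A : 'M[rat]_(n, m)) :
  te_lace A -> is_hilbert_basis A (rows_set A `|` [fset 2^-1 *: sum_rows A]).
Proof.
move=> hA; have [[h1 h2 _] _ _] := hA; have n1 := te_lace_size hA.
have [hL lat] := te_lace_lattice hA.
apply: (@hilbert_basis_criterion _ _ _ _ (fun l => is_unit_vec l \/ l = const_mx 2^-1)) => //.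
- move=> x; rewrite in_fsetU in_fset1; split.
    case/orP=> [/rows_setP[l h ->]|/eqP ->]; first by exists l => //; left.
    by exists (const_mx 2^-1); rewrite ?const_mulmx //; right.
  case=> l [h ->|-> ->]; apply/orP; [left|right]; last by rewrite const_mulmx.
  by apply/rows_setP; exists l.
- move=> l [h|->]; split=> //; first by move=> i; apply: unit_vec_ge0.
    exact: inL_unit_vec.
  by move=> i; rewrite mxE.
- move=> P P0 PD PT l l0 /lat hl.
  have PU k : is_unit_vec k -> P k by move=> hk; apply: PT; left.
  case: hl => lZ.
    by apply: row_nat_ind.
  rewrite -(subrK (const_mx 2^-1) l); apply: (PD); last by apply: PT; right.
  apply: row_nat_ind => // i; move/mxOverP/(_ 0 i): lZ; rewrite !mxE => /intrP[z e].
  rewrite e ler0z.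
  have : (- 1)%:~R < z%:~R :> rat by rewrite -e /=; have := l0 i; lra.
  by rewrite ltr_int; lia.
(* Mixed comparisons fail: a unit vector has a 1 above 1/2 and, as [n > 1], a 0 below it. *)
- move=> l l' [h|->] [h'|->] hle //.
  + by apply: le_sum_eq => //; rewrite !unit_vec_sum.
  + by have [i e] := unit_vec_one h; have := hle i; rewrite e mxE.
  + by have [i e] := unit_vec_zero n1 h'; have := hle i; rewrite e mxE.
- case=> [/unit_vec_one[i /eqP]|/rowP/(_ (Ordinal n1)) /eqP]; rewrite !mxE.
    by rewrite eq_sym oner_eq0.
  by [].
Qed.

Lemma thin_hilbert_basis (n m : nat) (A : 'M[rat]_(n, m)) :
  thin_te_interlace A -> is_hilbert_basis A (rows_set A `|` half_pairs A).
Proof.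
move=> hT; have [hA _] := hT; have [[h1 h2 _] _ _] := hA.
apply: (hilbert_basis_criterion h2 (rows_half_pairsP A)).
- move=> l h; split=> [i|]; first exact: unit_or_pair_ge0.
  exact: unit_or_pair_inL.
- by move=> P P0 PD PT l l0; rewrite (thin_inL l hT); apply: inD_nonneg_ind.
(* All members have coordinate sum 1, so comparable ones coincide. *)
- by move=> l l' h h' hle; apply: le_sum_eq => //; rewrite !unit_or_pair_sum.
- move/unit_or_pair_sum/eqP; rewrite big1 ?[_ == 1]eq_sym ?oner_eq0 // => i _.
  by rewrite mxE.
Qed.

(* Incomparability: a unit vector or half-pair has a coordinate 0, and either a
   coordinate 1 or two coordinates 1/2, whereas the vectors of [T] have no
   coordinate 0 or 1 and at most one coordinate above 1/4. *)
Lemma thick_hilbert_basis (n m : nat) (A : 'M[rat]_(n, m)) (T : 'rV[rat]_n -> Prop)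
    (H : {fset 'rV[rat]_m}) s :
  thick_te_interlace A ->
  (forall x, x \in H <-> exists2 l, T l & x = l *m A) ->
  (forall l, T l -> inL A l) ->
  (forall l i, T l -> 4^-1 <= l 0 i < 1) ->
  (forall l i j, T l -> i != j -> l 0 i = 4^-1 \/ l 0 j = 4^-1) ->
  (forall l, T l -> \sum_i l 0 i = s) ->
  (forall l : 'rV_n, inL A l -> (forall i, 4^-1 <= l 0 i) -> (forall i, odd_int (4 * l 0 i)) ->
    exists2 k, T k & forall i, k 0 i <= l 0 i) ->
  is_hilbert_basis A (rows_set A `|` half_pairs A `|` H).
Proof.
move=> hT HT TL Tb T2 Ts Tge; have [hA _] := hT; have [[h1 h2 _] _ _] := hA.
have n2 := thick_size hT.
have T4 l i : T l -> 4^-1 <= l 0 i by move=> h; have /andP[] := Tb l i h.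
have T1 l i : T l -> l 0 i < 1 by move=> h; have /andP[] := Tb l i h.
apply: (@hilbert_basis_criterion _ _ _ _ (fun l => is_unit_or_pair l \/ T l)) => //.
- move=> x; rewrite in_fsetU; split.
    by case/orP=> [/rows_half_pairsP|/HT] [l h ->]; exists l => //; [left|right].
  case=> l [h|h] e; apply/orP; [left|right]; last by apply/HT; exists l.
  by apply/rows_half_pairsP; exists l.
- move=> l [h|h]; split.
  + by move=> i; apply: unit_or_pair_ge0.
  + exact: unit_or_pair_inL.
  + by move=> i; apply: le_trans (T4 _ i h).
  + exact: TL.
- move=> P P0 PD PT l l0 lL.
  have PD' (k : 'rV_n) : (forall i, 0 <= k 0 i) -> inD k -> P k.
    apply: (inD_nonneg_ind P0 PD) => k' hk'; apply: PT; left; exact: hk'.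
  have [|lo] := thick_inL hT lL; first exact: PD'.
  have l4 i : 4^-1 <= l 0 i.
    have := odd_int_int (lo i); rewrite intrEge0 ?mulr_ge0 // => /natrP[[|k] e].
      by have := odd_int_half (lo i); rewrite e mulr0 rpred0.
    have : (0 : rat) <= k%:R by rewrite ler0n.
    by move: e; rewrite -[k.+1%:R]natr1; lra.
  have [k Tk kl] := Tge l lL l4 lo.
  rewrite -(subrK k l); apply: PD; last by apply: PT; right.
  have dL : inL A (l - k) by apply: inLB => //; apply: TL.
  apply: PD' => [i|]; first by rewrite !mxE subr_ge0.
  (* At a coordinate where [k] equals 1/4, four times [l - k] is even; so [l - k] is not in the odd
     coset and lies in half of [D_n]. *)
  have [//|ho] := thick_inL hT dL.
  have n0 : (0 < n)%N by apply: ltn_trans n2.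
  have [i hi] : exists i, k 0 i = 4^-1.
    have ij : Ordinal n0 != Ordinal n2 by [].
    by case: (T2 k _ _ Tk ij) => e; [exists (Ordinal n0) | exists (Ordinal n2)].
  have := odd_int_half (ho i); rewrite !mxE hi.
  have -> : 2^-1 * (4 * (l 0 i - 4^-1)) = 2^-1 * (4 * l 0 i - 1) by field.
  by have := lo i; rewrite /odd_int => ->.
- move=> l l' [h|h] [h'|h'] hle.
  + by apply: le_sum_eq => //; rewrite !unit_or_pair_sum.
  + case: h => [/unit_vec_one[i e]|/half_pair_half[i [j [ij ei ej]]]].
      by have := hle i; rewrite e leNgt T1.
    by case: (T2 _ _ _ h' ij) => e; [have := hle i | have := hle j]; rewrite e ?ei ?ej.
  + by have [i e] := unit_or_pair_zero n2 h'; have := le_trans (T4 _ i h) (hle i); rewrite e.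
  + by apply: le_sum_eq => //; rewrite !Ts.
- case=> [/unit_or_pair_sum/eqP|h].
    rewrite big1 ?[_ == 1]eq_sym ?oner_eq0 // => i _; by rewrite mxE.
  have n0 : (0 < n)%N by apply: ltn_trans n2.
  by have := T4 _ (Ordinal n0) h; rewrite mxE.
Qed.

Lemma thick_center_hilbert_basis (n m : nat) (A : 'M[rat]_(n, m)) :
  thick_te_interlace A -> inL A (const_mx 4^-1) ->
  is_hilbert_basis A (rows_set A `|` half_pairs A `|` [fset 4^-1 *: sum_rows A]).
Proof.
move=> hT hc; apply: (@thick_hilbert_basis _ _ _ (fun l => l = const_mx 4^-1) _
  (\sum_i (const_mx 4^-1 : 'rV[rat]_n) 0 i)) => //.
- move=> x; rewrite in_fset1; split=> [/eqP ->|[l -> ->]].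
    by exists (const_mx 4^-1); rewrite ?const_mulmx.
  by rewrite const_mulmx.
- by move=> l ->.
- by move=> l i ->; rewrite mxE.
- by move=> l i j ->; rewrite mxE; left.
- by move=> l ->.
- by move=> l lL l4 lo; exists (const_mx 4^-1) => // i; rewrite mxE.
Qed.

Lemma thick_off_center_hilbert_basis (n m : nat) (A : 'M[rat]_(n, m)) :
  thick_te_interlace A ->
  (forall i, inL A (const_mx 4^-1 + 2^-1 *: delta_mx 0 i)) ->
  is_hilbert_basis A (rows_set A `|` half_pairs A `|` three_quarter_set A).
Proof.
move=> hT hc; have [hA _] := hT; have [[h1 h2 _] _ _] := hA.
apply: (@thick_hilbert_basis _ _ _ (@is_off_center n) _ (4^-1 * n%:R + 2^-1)) => //.
- exact: three_quarter_setP.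
- by move=> l [i ->].
- by move=> l i h; rewrite off_center_ge ?off_center_lt1.
- move=> l i j [k ->] ij; rewrite !mxE /=; have [e|ik] := eqVneq i k.
    right; rewrite -e eq_sym (negPf ij) mulr0 addr0 //.
  by left; rewrite mulr0 addr0.
- exact: off_center_sum.
move=> l lL l4 lo.
(* Otherwise all coordinates of [l] equal 1/4, and subtracting [l] from an off-center vector leaves
   half a unit vector in the lattice, which is impossible. *)
have [i hi] : exists i, 3 / 4 <= l 0 i.
  have [i hi|/= h0] := pickP (fun i => 3 / 4 <= l 0 i); first by exists i.
  have n0 : (0 < n)%N by apply: ltn_trans (thick_size hT).
  exfalso; have /negP := inL_half_delta (Ordinal n0) h1 h2; apply.
  set e := 2^-1 *: _; rewrite -[e](addKr l) addrC; apply: inLB => //.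
  suff -> : l = const_mx 4^-1 by exact: hc.
  apply/rowP=> i; rewrite mxE.
  have /odd_intP[z e'] := lo i; have := h0 i; have := l4 i => a1 /negbT; rewrite -ltNge => a2.
  have z0 : z = 0.
    have : (-1)%:~R < z%:~R :> rat by move: e'; rewrite rmorphD rmorphM /=; lra.
    have : z%:~R < 1%:~R :> rat by move: e'; rewrite rmorphD rmorphM /=; lra.
    by rewrite !ltr_int; lia.
  by move: e'; rewrite z0 /=; lra.
exists (const_mx 4^-1 + 2^-1 *: delta_mx 0 i)%R; first by exists i.
move=> k; rewrite !mxE /=; have [->|_] := eqVneq k i; rewrite /=; have := l4 k; lra.
Qed.

Theorem mainTheorem17 (n m : nat) (A : 'M[rat]_(n, m)) (hA : te_brick A) :
  [/\ tu_set A -> is_hilbert_basis A (rows_set A),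
      te_lace A ->
        is_hilbert_basis A (rows_set A `|` [fset 2^-1 *: sum_rows A]),
      thin_te_interlace A ->
        is_hilbert_basis A (rows_set A `|` half_pairs A) &
      thick_te_interlace A ->
        exists p : bool,
          [/\ forall j : 'I_m, col j A != 0 ->
                odd (count_col A j 1) = p /\ odd (count_col A j (-1)) = p,
              (n %% 4 = 2 * p %% 4)%N ->
                is_hilbert_basis A
                  (rows_set A `|` half_pairs A `|` [fset 4^-1 *: sum_rows A]) &
              (n %% 4 <> 2 * p %% 4)%N ->
                is_hilbert_basis A
                  (rows_set A `|` half_pairs A `|` three_quarter_set A)]].
Proof.
split; [exact: tu_hilbert_basis | exact: lace_hilbert_basis | exact: thin_hilbert_basis |].
move=> hT; have hn := thick_even hT; have n2 := thick_size hT.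
(* As [n] is even, the congruence of case (a) holds exactly when [p] is the parity of [n / 2]; the
   flipped parity belongs to case (b). *)
have n4 : (n %% 4 = 2 * odd n./2 %% 4)%N by lia.
case: (thick_center hT) => hc.
  exists (odd n./2); split=> // [j|_]; first exact: count_col_center.
  exact: thick_center_hilbert_basis.
exists (~~ odd n./2); split=> [j|e|_].
- exact: (count_col_off_center hT (hc (Ordinal n2))).
- by exfalso; lia.
- exact: thick_off_center_hilbert_basis.
Qed.
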